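(* Let $N\ge2$ be an integer, let $B\subset\mathbb{R}^N$ be the open unit ball, and let $\delta\ge N/2$. For $\lambda>0$ consider the problem $$(P_\lambda)\qquad -\Delta U=\frac{\lambda+\delta|\nabla U|^2}{1-U},\quad U>0\ \text{ in } B,\qquad U=0\ \text{ on }\partial B .$$ Then the following hold. (i) If $N=2$, then there exists $\lambda^{**}>0$ such that for each $\lambda\in(0,\lambda^{**})$ the problem $(P_\lambda)$ has infinitely many rupture solutions. Furthermore, if $\delta=1$ this holds with $\lambda^{**}=1$. (ii) If $N\ge3$ and $N/2\le\delta<N-1$, then for any $$0<\lambda<\lambda^{***}:=\frac{\delta(N-1-\delta)}{\delta-1}$$ the problem $(P_\lambda)$ has infinitely many rupture solutions $U(r)$ satisfying the following: (ii1) if $N/2<\delta<N-1$, then $$U(r)=1-\sqrt{\frac{\lambda}{N-1-\delta}}\;r\,(1+o(1))\quad\text{as } r\to0;$$ (ii2) if $\delta=N/2$, then there exists $c>1$ such that $$1-\sqrt{\frac{2\lambda}{N}}\,c\,r\le U(r)<1-\sqrt{\frac{2\lambda}{N}}\,r\quad\text{for } 0<r<1 .$$ (iii) If $N\ge3$ and $\delta\ge N-1$, then there exists $\lambda^{****}>0$ such that for each $\lambda\in(0,\lambda^{****})$ the problem $(P_\lambda)$ has infinitely many rupture solutions.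
   Context: A rupture solution of $(P_\lambda)$ is a radial function $U=U(r)$, $r=|x|$, continuous on $\overline B$, with $U(0)=1$ and $0<U<1$ in $B\setminus\{0\}$, $U=0$ on $\partial B$, satisfying the equation classically in $B\setminus\{0\}$ (the equation is singular at the origin). *)

(* Defs.v *)
From HB Require Import structures.
From mathcomp Require Import all_boot all_order all_algebra.
From mathcomp Require Import all_classical all_reals all_analysis.
Set Implicit Arguments.
Unset Strict Implicit.
Unset Printing Implicit Defensive.
Import Order.TTheory GRing.Theory Num.Theory.
Import numFieldNormedType.Exports.
Local Open Scope classical_set_scope.
Local Open Scope ring_scope.

Section Euclidean.
Context {R : realType} {N : nat}.
Implicit Types (U : 'rV[R]_N -> R) (x : 'rV[R]_N) (A : set 'rV[R]_N).

(* The library norm on 'rV[R]_N is the sup norm; it induces the usual topology,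
   but the radius r = |x| and the ball B are Euclidean. *)
Definition enorm x : R := Num.sqrt (\sum_(i < N) x 0 i ^+ 2).

Definition partial (i : 'I_N) U x : R := 'D_(delta_mx 0 i) U x.

Definition grad_sqr U x : R := \sum_(i < N) partial i U x ^+ 2.

Definition laplacian U x : R := \sum_(i < N) partial i (partial i U) x.

(* For open A: all partial derivatives of order 1 and 2 exist and are
   continuous at every point of A, i.e. U is of class C^2 on A. *)
Definition C2_on A U : Prop := forall x, A x -> forall i j : 'I_N,
  [/\ derivable U x (delta_mx 0 i),
      {for x, continuous (partial i U)},
      derivable (partial i U) x (delta_mx 0 j)
    & {for x, continuous (partial j (partial i U))}].

Definition unit_ball : set 'rV[R]_N := [set x | enorm x < 1].
Definition closed_unit_ball : set 'rV[R]_N := [set x | enorm x <= 1].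
Definition unit_sphere : set 'rV[R]_N := [set x | enorm x = 1].
Definition punctured_ball : set 'rV[R]_N := unit_ball `\ 0.

Definition radial_fun (u : R -> R) : 'rV[R]_N -> R := fun x => u (enorm x).

End Euclidean.

(* A rupture solution of (P_lambda) on the unit ball of R^N, given by its
   radial profile u, i.e. U(x) = u(|x|). Only u on [0, 1] matters. *)
Definition rupture_solution {R : realType} (N : nat) (delta lambda : R)
    (u : R -> R) : Prop :=
  let U : 'rV[R]_N -> R := radial_fun u in
  [/\ {within closed_unit_ball, continuous U},
      U 0 = 1,
      forall x, punctured_ball x -> 0 < U x < 1,
      forall x, unit_sphere x -> U x = 0
    & C2_on punctured_ball U /\
      forall x, punctured_ball x ->
        - laplacian U x = (lambda + delta * grad_sqr U x) / (1 - U x)].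

(* Profiles are compared on [0, 1] only, so that values of u outside [0, 1],
   which are not part of the solution, do not count as distinct solutions. *)
Definition infinitely_many_profiles {R : realType} (P : (R -> R) -> Prop) : Prop :=
  infinite_set [set u \_ `[0, 1]%classic | u in [set u : R -> R | P u]].

(* Main.v *)
(* Write [w = 1 - U], [s = - ln r] and [q = r w' / w].  The equation is invariant
   under [w(r) -> w(a r) / a], so in these variables it becomes the autonomous
   system [q_s = (N-2) q - (delta-1) q^2 - X], [X_s = 2 X (q-1)] with
   [X = lambda r^2 / w^2].  A rupture solution is a trajectory on [0, +oo[ with
   [X(0) = lambda], [q > 0] and [ln w = - int q -> - oo]; the initial slope
   [q(0)] is free, and different slopes give different solutions.

   Such trajectories are confined by explicit barriers.  For [N = 2] one has
   [q >= a / (1 + s)]; if moreover [delta = 1] then [(q-1)^2 + X] is conserved.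
   For [delta >= N-1] there is an invariant box.  For [N/2 <= delta < N-1], with
   [k = delta-1] and [m = N-1-delta], the quantity
   [((q-1)^2 + X/delta - m/k) X^k] is nonincreasing in [s], and it can be made
   negative at [s = 0] exactly when [lambda < delta m / k].  Negativity bounds
   [q] and bounds [X] above and away from 0; when [k > m] the dissipation forces
   [q -> 1] and [X -> m].  Trajectories are global because the vector field may
   be truncated to a bounded Lipschitz one outside the confining region. *)
Require Import Defs.
From HB Require Import structures.
From mathcomp Require Import all_boot all_order all_algebra.
From mathcomp Require Import all_classical all_reals all_analysis.
From mathcomp Require Import ring lra.
Set Implicit Arguments.
Unset Strict Implicit.
Unset Printing Implicit Defensive.
Import Order.TTheory GRing.Theory Num.Theory.
Import numFieldNormedType.Exports.
Local Open Scope classical_set_scope.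
Local Open Scope ring_scope.

(** * Differential inequalities *)

Section DerivativeRules.
Context {R : realType}.
Implicit Types (f g : R -> R) (x a b c : R).

(** The differentiation rules in pointwise form, the shape in which [derive_step] meets the
    functions below. *)
Lemma is_derive_fcst x c : is_derive x 1 (fun _ : R => c) 0.
Proof. exact: is_derive_cst. Qed.

Lemma is_derive_fid x : is_derive x 1 (fun s : R => s) 1.
Proof. exact: is_derive_id. Qed.

Lemma is_derive_fD f g x a b : is_derive x 1 f a -> is_derive x 1 g b ->
  is_derive x 1 (fun s => f s + g s) (a + b).
Proof. exact: is_deriveD. Qed.

Lemma is_derive_fN f x a : is_derive x 1 f a ->
  is_derive x 1 (fun s => - f s) (- a).
Proof. exact: is_deriveN. Qed.

Lemma is_derive_fM f g x a b : is_derive x 1 f a -> is_derive x 1 g b ->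
  is_derive x 1 (fun s => f s * g s) (f x * b + g x * a).
Proof. exact: is_deriveM. Qed.

Lemma is_derive_fX f n x a : is_derive x 1 f a ->
  is_derive x 1 (fun s => f s ^+ n) (n%:R * f x ^+ n.-1 * a).
Proof.
move=> h; have -> : (fun s => f s ^+ n) = f ^+ n by apply/funext => s; rewrite fctE.
exact: is_deriveX.
Qed.

Lemma is_derive_fV f x a : f x != 0 -> is_derive x 1 f a ->
  is_derive x 1 (fun s => (f s)^-1) (- (f x) ^- 2 * a).
Proof. move=> h1 h2; exact: is_deriveV. Qed.

Lemma is_derive_fexpR f x a : is_derive x 1 f a ->
  is_derive x 1 (fun s => expR (f s)) (expR (f x) * a).
Proof. move=> h; exact: (@is_derive1_comp _ expR). Qed.

Lemma is_derive_fln f x a : 0 < f x -> is_derive x 1 f a ->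
  is_derive x 1 (fun s => ln (f s)) ((f x)^-1 * a).
Proof. by move=> h0 h; apply: (@is_derive1_comp _ (@ln R)); apply: is_derive1_ln. Qed.

Lemma is_derive_cvg f x a : is_derive x 1 f a -> {for x, continuous f}.
Proof. by case=> h _; apply/differentiable_continuous/derivable1_diffP. Qed.

End DerivativeRules.

Ltac derive_step :=
  first [ eassumption
        | notypeclasses refine (@is_derive_fcst _ _ _)
        | notypeclasses refine (@is_derive_fid _ _)
        | notypeclasses refine (@is_derive_fD _ _ _ _ _ _ _ _)
        | notypeclasses refine (@is_derive_fN _ _ _ _ _)
        | notypeclasses refine (@is_derive_fM _ _ _ _ _ _ _ _)
        | notypeclasses refine (@is_derive_fX _ _ _ _ _ _)
        | notypeclasses refine (@is_derive_fexpR _ _ _ _ _) ].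
(** Computes a derivative by structural rules and leaves only the equality with the announced
    value. *)
Ltac derive_tac := notypeclasses refine (@is_derive_eq _ _ _ _ _ _ _ _ _ _); [repeat derive_step | cbv beta ].

Section Comparison.
Context {R : realType}.
Implicit Types (f g df dg : R -> R) (a b s : R).

Lemma ge0_derive_homo f df a b : a <= b ->
  (forall s, a <= s <= b -> is_derive s 1 f (df s)) ->
  (forall s, a < s < b -> 0 <= df s) -> f a <= f b.
Proof.
move=> ab fdf df0.
apply: (@ger0_derive1_ndecr R f a b) => //.
- by move=> x; rewrite in_itv /= => /andP[h1 h2]; have [] := fdf x; rewrite ?ltW.
- move=> x; rewrite in_itv /= => /andP[h1 h2].
  have [] := fdf x; first by rewrite !ltW.
  by move=> _; rewrite derive1E => ->; apply: df0; rewrite h1.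
- apply: derivable_within_continuous => x; rewrite in_itv /= => h.
  by have [] := fdf x h.
Qed.

Lemma is_derive_le f df g dg : f 0 <= g 0 ->
  (forall s, 0 <= s -> is_derive s 1 f (df s)) ->
  (forall s, 0 <= s -> is_derive s 1 g (dg s)) ->
  (forall s, 0 <= s -> df s <= dg s) -> forall s, 0 <= s -> f s <= g s.
Proof.
move=> fg0 hf hg hd s s0.
have : g 0 + - f 0 <= g s + - f s.
  apply: (@ge0_derive_homo (fun s => g s + - f s) (fun s => dg s + - df s)) => //.
  - move=> t /andP[t0 _]; have := hf t t0; have := hg t t0 => ? ?; derive_tac; ring.
  - by move=> t /andP[t0 _]; rewrite subr_ge0; apply: hd; apply: ltW.
move: fg0; lra.
Qed.

Lemma is_derive_norm_le f df g dg : `|f 0| <= g 0 ->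
  (forall s, 0 <= s -> is_derive s 1 f (df s)) ->
  (forall s, 0 <= s -> is_derive s 1 g (dg s)) ->
  (forall s, 0 <= s -> `|df s| <= dg s) -> forall s, 0 <= s -> `|f s| <= g s.
Proof.
move=> fg0 hf hg hd s s0; rewrite ler_norml; apply/andP; split.
- rewrite lerNl; apply: (@is_derive_le (fun s => - f s) (fun s => - df s) g dg) => //.
  + by move: fg0; rewrite ler_norml => /andP[]; rewrite lerNl.
  + by move=> t t0; apply: is_derive_fN; apply: hf.
  + by move=> t t0; have := hd t t0; rewrite ler_norml => /andP[]; rewrite lerNl.
- apply: (@is_derive_le f df g dg) => //.
  + by move: fg0; rewrite ler_norml => /andP[].
  + by move=> t t0; have := hd t t0; rewrite ler_norml => /andP[].
Qed.

(* Only the layer [- eps < f < 0] matters, since [f] must cross it to become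
   negative; there the truncations of the vector field are still inactive. *)
Lemma barrier f df (eps : R) : 0 < eps -> 0 <= f 0 ->
  (forall s, 0 <= s -> is_derive s 1 f (df s)) ->
  (forall s, 0 <= s -> - eps < f s -> f s < 0 -> 0 <= df s) ->
  forall s, 0 <= s -> 0 <= f s.
Proof.
move=> eps0 f0 fdf hbar s s0; rewrite leNgt; apply/negP => fs.
have fc x : 0 <= x -> {for x, continuous f} by move=> x0; exact: is_derive_cvg (fdf x x0).
(* The supremum [c] of [A] is the last time up to [s] at which [f] is nonnegative, so that [f < 0]
   on []c, s]]. *)
pose A : set R := [set t | 0 <= t <= s /\ 0 <= f t].
have A0 : A 0 by rewrite /A /= lexx s0.
have As : ubound A s by move=> t [/andP[]].
have hsA : has_sup A by split; [exists 0 | exists s].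
pose c := sup A.
have c0 : 0 <= c by apply: ub_le_sup => //; exists s.
have cs : c <= s by apply: ge_sup => //; exists 0.
have fcge : 0 <= f c.
  rewrite leNgt; apply/negP => fcn.
  have : \forall t \near c, f t < 0.
    exact: (cvgr_lt _ (fc c c0)).
  move=> /nbhs_ballP[d d0 hd].
  have [t At ct] := sup_adherent (d0 : 0 < d) hsA.
  have tc : t <= c by apply: ub_le_sup => //; exists s.
  have : f t < 0.
    apply: hd; rewrite /ball /= ger0_norm ?subr_ge0 //.
    by move: ct; rewrite -/c; lra.
  by case: At => _; rewrite leNgt => /negP.
have cs' : c < s by rewrite lt_neqAle cs andbT; apply: contraTneq fs => <-; rewrite -leNgt.
have fn t : c < t <= s -> f t < 0.
  move=> /andP[ct ts]; rewrite ltNge; apply/negP => ft.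
  have : t <= c by apply: ub_le_sup; [exists s| split => //; rewrite ts (le_trans c0) ?ltW].
  by rewrite leNgt ct.
have : \forall t \near c, - eps < f t.
  by apply: (cvgr_gt _ (fc c c0)); apply: lt_le_trans fcge; rewrite oppr_lt0.
move=> /nbhs_ballP[d d0 hd].
(* Between [c] and [t] the values of [f] stay in the layer, where [f] cannot decrease; hence
   [0 <= f c <= f t], although [f t < 0]. *)
pose t := Num.min s (c + d / 2).
have ct : c < t by rewrite lt_min cs' /= ltrDl divr_gt0.
have ts : t <= s by rewrite ge_min lexx.
have td : t <= c + d / 2 by rewrite ge_min lexx orbT.
have : f c <= f t.
  apply: (@ge0_derive_homo f df); first exact: ltW.
  - by move=> x /andP[cx _]; apply: fdf; apply: le_trans cx.
  - move=> x /andP[cx xt]; apply: hbar.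
    + by apply: le_trans c0 _; apply: ltW.
    + apply: hd; rewrite /ball /= ltr0_norm ?subr_lt0 //.
      by move: xt td d0; lra.
    + by apply: fn; rewrite cx (ltW (lt_le_trans xt ts)).
by apply/negP; rewrite -ltNge; apply: lt_le_trans fcge; apply: fn; rewrite ct.
Qed.

Lemma antiderivative f (c : R) : continuous f ->
  exists2 F, F 0 = c & forall s, 0 <= s -> is_derive s 1 F (f s).
Proof.
move=> cf.
(* Integration starts at [-1], not at [0], so that the primitive has a two-sided derivative at [0]
   as well. *)
pose A (x : R) : R := (\int[lebesgue_measure]_(t in [set` `[(-1)%R, x]]) (f t))%R.
exists (fun x => A x + (c - A 0)); first by rewrite addrC subrK.
move=> s s0.
have fi : (@lebesgue_measure R).-integrable `[(-1)%R, s + 1] (EFin \o f).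
  apply: continuous_compact_integrable; first exact: segment_compact.
  exact: continuous_subspaceT.
have s1 : s < s + 1 by rewrite ltrDl.
have s2 : -1 < s by apply: lt_le_trans s0; lra.
have [dA eA] := continuous_FTC1_closed s1 fi s2 (cf s).
have : is_derive s 1 A (f s) by apply: DeriveDef; [exact: dA | rewrite -derive1E; exact: eA].
by move=> ?; derive_tac; rewrite addr0.
Qed.

End Comparison.

(** * Global solutions for bounded Lipschitz fields *)

Section Picard.
Context {R : realType}.
Implicit Types (f g df : R -> R) (s t : R).

Local Notation h := (2^-1 : R).

Lemma le_of_geometric (x y C : R) : (forall n, x <= y + C * h ^+ n) -> x <= y.
Proof.
move=> H; apply/ler_addgt0Pr => e e0.
have [C0|C0] := leP C 0.
  apply: le_trans (H 0%N) _; rewrite expr0 mulr1; lra.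
have : h ^+ n @[n --> \oo] --> (0 : R).
  by apply: cvg_expr; rewrite ger0_norm; lra.
move=> /cvgr_lt /(_ (e / C)) /(_ (divr_gt0 e0 C0)) [n _ hn].
apply: le_trans (H n) _; rewrite lerD2l.
have := hn n (leqnn n); rewrite /= ltr_pdivlMr // mulrC => ?; exact: ltW.
Qed.

(** The lower bounds [u n - 2 * K * h ^+ n] increase and the upper bounds [u n + 2 * K * h ^+ n]
    decrease; the supremum of the former lies between both families. *)
Lemma geometric_limit (u : nat -> R) (K : R) :
  (forall n, `|u n.+1 - u n| <= K * h ^+ n) ->
  exists l, forall n, `|l - u n| <= 2 * K * h ^+ n.
Proof.
move=> hu.
have hK n : h ^+ n.+1 = h ^+ n / 2 by rewrite exprSr.
pose v n := u n - 2 * K * h ^+ n; pose w n := u n + 2 * K * h ^+ n.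
have hv : {homo v : m n / (m <= n)%N >-> m <= n}.
  apply: homo_leq => // [? ? ?|n]; first exact: le_trans.
  have := hu n; rewrite /v hK ler_norml => /andP[]; lra.
have hw : {homo w : m n / (m <= n)%N >-> n <= m}.
  apply: homo_leq => // [y x z h1 h2|n]; first exact: (le_trans h2 h1).
  have := hu n; rewrite /w hK ler_norml => /andP[]; lra.
have K0 : 0 <= K by have := hu 0%N; rewrite expr0 mulr1; apply: le_trans.
have vw m n : v m <= w n.
  apply: le_trans (hv _ _ (leq_maxl m n)) _; apply: le_trans (hw _ _ (leq_maxr m n)).
  have : 0 <= K * h ^+ maxn m n by rewrite mulr_ge0 // exprn_ge0 //; lra.
  rewrite /v /w; lra.
have hs : has_sup (range v) by split; [exists (v 0%N), 0%N | exists (w 0%N) => _ [n _ <-]].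
exists (sup (range v)) => n; rewrite ler_norml; apply/andP; split.
- have : v n <= sup (range v) by apply: ub_le_sup; [case: hs | exists n].
  rewrite /v; lra.
- have : sup (range v) <= w n by apply: ge_sup; [case: hs | move=> _ [m _ <-]].
  rewrite /w; lra.
Qed.

Lemma lipschitz_continuous f (K : R) :
  (forall s t, `|f s - f t| <= K * `|s - t|) -> continuous f.
Proof.
move=> hf x; apply/cvgrPdist_le => e e0.
have K1 : 0 < `|K| + 1 by rewrite ltr_wpDl.
near=> t.
apply: le_trans (hf x t) _.
apply: (@le_trans _ _ ((`|K| + 1) * `|x - t|)).
  by apply: ler_wpM2r => //; rewrite (le_trans (ler_norm K)) // lerDl.
rewrite mulrC -ler_pdivlMr //.
near: t; apply: cvgr_dist_le; [exact: cvg_id | exact: divr_gt0].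
Unshelve. all: end_near. Qed.

(** Both [K * x + f x] and [K * x - f x] have nonnegative derivatives. *)
Lemma derive_bounded_lipschitz f df (K : R) :
  (forall s, 0 <= s -> is_derive s 1 f (df s)) ->
  (forall s, 0 <= s -> `|df s| <= K) ->
  forall s t, 0 <= s -> 0 <= t -> `|f s - f t| <= K * `|s - t|.
Proof.
move=> hf hK.
have key s t : 0 <= s -> s <= t -> `|f t - f s| <= K * (t - s).
  move=> s0 st; rewrite ler_norml; apply/andP; split.
  - suff : K * s + f s <= K * t + f t by lra.
    apply: (@ge0_derive_homo _ (fun x => K * x + f x) (fun x => K + df x)) => //.
    + move=> x /andP[sx _]; have := hf x (le_trans s0 sx) => ?; derive_tac; ring.
    + move=> x /andP[sx _]; have := hK x (le_trans s0 (ltW sx)).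
      by rewrite ler_norml => /andP[]; lra.
  - suff : K * s - f s <= K * t - f t by lra.
    apply: (@ge0_derive_homo _ (fun x => K * x - f x) (fun x => K - df x)) => //.
    + move=> x /andP[sx _]; have := hf x (le_trans s0 sx) => ?; derive_tac; ring.
    + move=> x /andP[sx _]; have := hK x (le_trans s0 (ltW sx)).
      by rewrite ler_norml => /andP[]; lra.
move=> s t s0 t0; have [st|ts] := leP s t.
  by rewrite distrC (distrC s) (ger0_norm (_ : 0 <= t - s)) ?subr_ge0 //; apply: key.
by rewrite (ger0_norm (_ : 0 <= s - t)) ?subr_ge0 ?(ltW ts)//; apply: key => //; apply: ltW.
Qed.

Lemma ler_dist_max s t (c : R) : `|Num.max s c - Num.max t c| <= `|s - t|.
Proof.
have := ler_norm (s - t); have := ler_norm (t - s); rewrite (distrC t) ler_norml.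
by case: (leP s c) => ?; case: (leP t c) => ? *; apply/andP; split; lra.
Qed.

Lemma ler_dist_min s t (c : R) : `|Num.min s c - Num.min t c| <= `|s - t|.
Proof.
have := ler_norm (s - t); have := ler_norm (t - s); rewrite (distrC t) ler_norml.
by case: (leP s c) => ?; case: (leP t c) => ? *; apply/andP; split; lra.
Qed.

(** Boundedness makes every iterate [B]-Lipschitz, and an exponential weight makes the integral
    operator a contraction on the whole half-line, so no continuation argument arises. *)
Theorem picard (F G : R -> R -> R) (L B a0 b0 : R) : 0 < L ->
  (forall x y x' y', `|F x y - F x' y'| <= L * (`|x - x'| + `|y - y'|)) ->
  (forall x y x' y', `|G x y - G x' y'| <= L * (`|x - x'| + `|y - y'|)) ->
  (forall x y, `|F x y| <= B) -> (forall x y, `|G x y| <= B) ->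
  exists a b : R -> R, [/\ a 0 = a0, b 0 = b0,
    forall s, 0 <= s -> is_derive s 1 a (F (a s) (b s))
  & forall s, 0 <= s -> is_derive s 1 b (G (a s) (b s))].
Proof.
move=> L0 hF hG bF bG.
have B0 : 0 <= B by apply: le_trans (bF 0 0).
(* A primitive with prescribed value at [0], chosen for all functions at once; it is meaningful for
   continuous ones only. *)
have [anti hanti] : {anti : (R -> R) * R -> R -> R & forall fc, continuous fc.1 ->
    anti fc 0 = fc.2 /\ forall s, 0 <= s -> is_derive s 1 (anti fc) (fc.1 s)}.
  apply: (@choice _ _ (fun fc A => continuous fc.1 ->
    A 0 = fc.2 /\ forall s, 0 <= s -> is_derive s 1 A (fc.1 s))) => -[f c] /=.
  have [cf|ncf] := pselect (continuous f); last by exists (cst 0).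
  by have [A A0 hA] := antiderivative c cf; exists A.
pose lip f := forall s t, 0 <= s -> 0 <= t -> `|f s - f t| <= B * `|s - t|.
(* Iterates are controlled on [[0, +oo[] only. Composing with [Num.max s 0] freezes the integrand at
   negative times and makes it continuous everywhere. *)
pose S (H : R -> R -> R) c f g := anti (fun s => H (f (Num.max s 0)) (g (Num.max s 0)), c).
have max0 s : 0 <= Num.max s 0 by rewrite le_max lexx orbT.
have HS (H : R -> R -> R) c f g :
    (forall x y x' y', `|H x y - H x' y'| <= L * (`|x - x'| + `|y - y'|)) ->
    lip f -> lip g -> S H c f g 0 = c /\
      forall s, 0 <= s -> is_derive s 1 (S H c f g) (H (f s) (g s)).
  move=> hH lf lg.
  have [|e1 e2] := hanti (fun s => H (f (Num.max s 0)) (g (Num.max s 0)), c).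
    apply: (@lipschitz_continuous _ (L * (B + B))) => s t /=.
    apply: le_trans (hH _ _ _ _) _; rewrite -mulrA ler_pM2l //.
    have hm : B * `|Num.max s 0 - Num.max t 0| <= B * `|s - t|.
      by apply: ler_wpM2l => //; apply: ler_dist_max.
    rewrite mulrDl; apply: lerD; apply: le_trans hm; [apply: lf|apply: lg] => //.
  by split => // s s0; have := e2 s s0; rewrite /= max_l.
have Slip H c f g :
    (forall x y x' y', `|H x y - H x' y'| <= L * (`|x - x'| + `|y - y'|)) ->
    (forall x y, `|H x y| <= B) ->
    lip f -> lip g -> lip (S H c f g).
  move=> hH bH lf lg; have [_ hd] := HS H c f g hH lf lg.
  move=> s t s0 t0.
  by apply: (@derive_bounded_lipschitz _ (fun s => H (f s) (g s))).
pose E s := expR (4 * L * s).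
have E0 s : 0 < E s by apply: expR_gt0.
have dE s : is_derive s 1 E (4 * L * E s) by rewrite /E; derive_tac; ring.
(* Picard's operator halves distances measured with the weight [expR (4 * L * s)]. *)
have Scontr H c f g f' g' (K : R) :
    (forall x y x' y', `|H x y - H x' y'| <= L * (`|x - x'| + `|y - y'|)) ->
    lip f -> lip g -> lip f' -> lip g' -> 0 <= K ->
    (forall s, 0 <= s -> `|f s - f' s| <= K * E s) ->
    (forall s, 0 <= s -> `|g s - g' s| <= K * E s) ->
    forall s, 0 <= s -> `|S H c f g s - S H c f' g' s| <= K / 2 * E s.
  move=> hH lf lg lf' lg' K0 hf hg.
  have [e1 d1] := HS H c f g hH lf lg.
  have [e2 d2] := HS H c f' g' hH lf' lg'.
  apply: (@is_derive_norm_le _ (fun s => S H c f g s - S H c f' g' s)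
     (fun s => H (f s) (g s) - H (f' s) (g' s))
     (fun s => K / 2 * E s) (fun s => 2 * L * K * E s)).
  - rewrite e1 e2 subrr normr0; apply: mulr_ge0; [lra|exact: ltW].
  - move=> s s0; have := d1 s s0; have := d2 s s0 => ? ?; derive_tac; ring.
  - move=> s s0; have := dE s => ?; derive_tac; by field.
  - move=> s s0; apply: le_trans (hH _ _ _ _) _.
    have -> : 2 * L * K * E s = L * (K * E s + K * E s) by ring.
    by rewrite ler_pM2l // lerD ?hf ?hg.
pose p := fix p n := if n is n.+1 then
  (S F a0 (p n).1 (p n).2, S G b0 (p n).1 (p n).2) else (cst a0, cst b0).
have lp n : lip (p n).1 /\ lip (p n).2.
  elim: n => [|n [l1 l2]] /=; last by split; apply: Slip.
  by split=> s t _ _; rewrite /= subrr normr0 mulr_ge0.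
(* With this value [M * E] has derivative [B * E], which is at least [B]; it therefore dominates the
   first increment. *)
pose M := B / (4 * L).
have M0 : 0 <= M by rewrite divr_ge0 // mulr_ge0 // ltW.
have hp n : (forall s, 0 <= s -> `|(p n.+1).1 s - (p n).1 s| <= M * h ^+ n * E s) /\
            (forall s, 0 <= s -> `|(p n.+1).2 s - (p n).2 s| <= M * h ^+ n * E s).
  elim: n => [|n [h1 h2]].
    have base (H : R -> R -> R) c f :
        (forall x y x' y', `|H x y - H x' y'| <= L * (`|x - x'| + `|y - y'|)) ->
        (forall x y, `|H x y| <= B) -> (forall s, f s = c) ->
        forall s, 0 <= s -> `|S H c (cst a0) (cst b0) s - f s| <= M * h ^+ 0 * E s.
      move=> hH bH fE; have [l1 l2] := lp 0%N.
      have [e1 d1] := HS H c (cst a0) (cst b0) hH l1 l2.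
      move=> s s0; rewrite fE; move: s s0.
      apply: (@is_derive_norm_le _ (fun s => S H c (cst a0) (cst b0) s - c)
        (fun=> H a0 b0) (fun s => M * h ^+ 0 * E s) (fun s => B * E s)).
      - by rewrite e1 subrr normr0 expr0 mulr1 mulr_ge0 // ltW.
      - move=> s s0; have := d1 s s0 => /= ?; derive_tac; ring.
      - move=> s s0; have := dE s => ?; derive_tac; rewrite /M; field.
        by rewrite gt_eqF.
      - move=> s s0; apply: le_trans (bH _ _) _; apply: ler_peMr => //.
        by rewrite -expR0 ler_expR !mulr_ge0 // ltW.
    by split; apply: base.
  have [l1 l2] := lp n; have [l3 l4] := lp n.+1.
  have K0 : 0 <= M * h ^+ n by rewrite mulr_ge0 // exprn_ge0 //; lra.
  by split=> s s0; rewrite exprSr mulrA; apply: Scontr.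
have lim1 (u : nat -> R -> R) :
    (forall n s, 0 <= s -> `|u n.+1 s - u n s| <= M * h ^+ n * E s) ->
    {l : R -> R & forall s, 0 <= s -> forall n,
      `|l s - u n s| <= 2 * (M * E s) * h ^+ n}.
  move=> hu; apply: (@choice _ _ (fun s l => 0 <= s -> forall n,
      `|l - u n s| <= 2 * (M * E s) * h ^+ n)) => s.
  have [s0|s0] := leP 0 s; last by exists 0.
  have [|l hl] := @geometric_limit (u ^~ s) (M * E s); last by exists l.
  by move=> n; have := hu n s s0; rewrite mulrAC.
have [x hx] := lim1 (fun n => (p n).1) (fun n => (hp n).1).
have [y hy] := lim1 (fun n => (p n).2) (fun n => (hp n).2).
have liplim u l : (forall n, lip (u n)) -> (forall s, 0 <= s -> forall n,
      `|l s - u n s| <= 2 * (M * E s) * h ^+ n) -> lip l.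
  move=> lu hl s t s0 t0.
  apply: (@le_of_geometric _ _ (2 * (M * E s) + 2 * (M * E t))) => n.
  have -> : l s - l t = (u n s - u n t) + (l s - u n s) + - (l t - u n t) by ring.
  apply: le_trans (ler_normD _ _) _; rewrite normrN.
  apply: le_trans (lerD (ler_normD _ _) (lexx _)) _.
  have := lu n s t s0 t0; have := hl s s0 n; have := hl t t0 n; lra.
have lx := liplim _ _ (fun n => (lp n).1) hx.
have ly := liplim _ _ (fun n => (lp n).2) hy.
have [e1 d1] := HS F a0 x y hF lx ly.
have [e2 d2] := HS G b0 x y hG lx ly.
(* The image of the limit and the limit are both within [O(h ^+ n)] of the iterate [n.+1], for every
   [n]. *)
have fixlim H c (u : nat -> R -> R) l :
    (forall x y x' y', `|H x y - H x' y'| <= L * (`|x - x'| + `|y - y'|)) ->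
    (forall n, u n.+1 = S H c (p n).1 (p n).2) ->
    (forall s, 0 <= s -> forall n, `|l s - u n s| <= 2 * (M * E s) * h ^+ n) ->
    forall s, 0 <= s -> S H c x y s = l s.
  move=> hH uS hl s s0; apply/eqP; rewrite -subr_eq0 -normr_le0.
  apply: (@le_of_geometric _ _ (2 * (M * E s))) => n.
  have := hl s s0 n.+1; rewrite uS exprSr add0r => h1.
  have hM : 0 <= 2 * M * h ^+ n by apply: mulr_ge0; [apply: mulr_ge0 | apply: exprn_ge0; lra].
  have [l1 l2] := lp n.
  have hx' t : 0 <= t -> `|x t - (p n).1 t| <= 2 * M * h ^+ n * E t.
    by move=> t0; rewrite (_ : _ * E t = 2 * (M * E t) * h ^+ n); [exact: hx | ring].
  have hy' t : 0 <= t -> `|y t - (p n).2 t| <= 2 * M * h ^+ n * E t.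
    by move=> t0; rewrite (_ : _ * E t = 2 * (M * E t) * h ^+ n); [exact: hy | ring].
  have := @Scontr H c _ _ _ _ _ hH lx ly l1 l2 hM hx' hy' s s0 => h2.
  have -> : S H c x y s - l s = (S H c x y s - S H c (p n).1 (p n).2 s)
    + - (l s - S H c (p n).1 (p n).2 s) by ring.
  apply: le_trans (ler_normD _ _) _; rewrite normrN.
  by lra.
have ex := fixlim F a0 (fun n => (p n).1) x hF (fun=> erefl) hx.
have ey := fixlim G b0 (fun n => (p n).2) y hG (fun=> erefl) hy.
(* The limits [x] and [y] are arbitrary at negative times, so may fail to be derivable at [0]; their
   images agree with them for [s >= 0] and are derivable there. *)
exists (S F a0 x y), (S G b0 x y); split => // s s0; rewrite ex // ey //.
- exact: d1.
- exact: d2.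
Qed.

End Picard.

(** * Truncated vector fields *)

Section Truncation.
Context {R : realType}.
Implicit Types (a b c x y s : R).

Definition clamp a b x : R := Num.max (Num.min x b) a.

Lemma clamp_in a b x : a <= b -> a <= clamp a b x <= b.
Proof. by move=> ab; rewrite /clamp le_max lexx orbT ge_max ab ge_min lexx orbT. Qed.

Lemma clamp_id a b x : a <= x <= b -> clamp a b x = x.
Proof. by move=> /andP[ax xb]; rewrite /clamp min_l // max_l. Qed.

Lemma clamp_lipschitz a b x y : `|clamp a b x - clamp a b y| <= `|x - y|.
Proof. exact: le_trans (ler_dist_max _ _ _) (ler_dist_min _ _ _). Qed.

(** The tangent inequality [1 + z <= expR z] bounds the increment by the slope at the larger
    argument, which is at most [c]. *)
Lemma expR_min_lipschitz c x y :
  `|expR (2 * Num.min x c) - expR (2 * Num.min y c)| <= 2 * expR (2 * c) * `|x - y|.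
Proof.
have key u v : u <= v -> v <= c -> `|expR (2 * v) - expR (2 * u)| <= 2 * expR (2 * c) * (v - u).
  move=> uv vc; have h0 : 0 <= expR (2 * v) - expR (2 * u).
    by rewrite subr_ge0 ler_expR; lra.
  rewrite (ger0_norm h0).
  have -> : expR (2 * u) = expR (2 * v) * expR (2 * u - 2 * v).
    by rewrite -expRD; congr expR; ring.
  have h1 := expR_ge1Dx (2 * u - 2 * v).
  apply: (@le_trans _ _ (expR (2 * v) * (2 * (v - u)))).
    have := ler_wpM2l (expR_ge0 (2 * v)) h1; lra.
  have h2 : expR (2 * v) <= expR (2 * c) by rewrite ler_expR; lra.
  have := ler_wpM2r (_ : 0 <= 2 * (v - u)) h2; lra.
apply: (@le_trans _ _ (2 * expR (2 * c) * `|Num.min x c - Num.min y c|)); last first.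
  by apply: ler_wpM2l (ler_dist_min _ _ _); rewrite mulr_ge0 // expR_ge0.
have cx z : Num.min z c <= c by rewrite ge_min lexx orbT.
have [xy|/ltW yx] := leP (Num.min x c) (Num.min y c).
  rewrite distrC (distrC (Num.min x c)) (ger0_norm (_ : 0 <= Num.min y c - Num.min x c)).
    exact: key.
  by rewrite subr_ge0.
rewrite (ger0_norm (_ : 0 <= Num.min x c - Num.min y c)); last by rewrite subr_ge0.
exact: key.
Qed.

(** Clamping [q] and capping [l] tames the quadratic and exponential terms. The truncation is
    removed by [flow_of_truncated] once the trajectory is known to stay where it is inactive. *)
Lemma truncated_flow (n k lam a b c beta : R) : a <= b ->
  exists l q : R -> R, [/\ l 0 = 0, q 0 = beta,
    forall s, 0 <= s -> is_derive s 1 l (clamp a b (q s) - 1)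
  & forall s, 0 <= s -> is_derive s 1 q
      (n * clamp a b (q s) - k * clamp a b (q s) ^+ 2 - lam * expR (2 * Num.min (l s) c))].
Proof.
move=> ab; pose C := clamp a b; pose m := `|a| + `|b|.
have m0 : 0 <= m by rewrite addr_ge0.
have Cm x : `|C x| <= m.
  have /andP[h1 h2] := @clamp_in a b x ab; rewrite -/C in h1 h2.
  have := ler_norm b; have := ler_norm (- a); rewrite normrN => h3 h4.
  have := normr_ge0 a; have := normr_ge0 b.
  by rewrite ler_norml /m => ? ?; apply/andP; split; lra.
pose e := expR (2 * c).
have e0 : 0 < e by exact: expR_gt0.
have ec x : `|expR (2 * Num.min x c)| <= e.
  rewrite ger0_norm ?expR_ge0 // ler_expR ler_pM2l // ge_min lexx orbT //.
pose L := 1 + `|n| + `|k| * (2 * m) + `|lam| * (2 * e).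
have L1 : 0 <= `|n| by []. have L2 : 0 <= `|k| * (2 * m) by rewrite !mulr_ge0.
have L3 : 0 <= `|lam| * (2 * e) by rewrite !mulr_ge0 // ltW.
have L0 : 0 < L by rewrite /L; lra.
pose B := 1 + m + `|n| * m + `|k| * m ^+ 2 + `|lam| * e.
have B1 : 0 <= `|n| * m by rewrite mulr_ge0.
have B2 : 0 <= `|k| * m ^+ 2 by rewrite mulr_ge0 // exprn_ge0.
have B3 : 0 <= `|lam| * e by rewrite mulr_ge0 // ltW.
have [] := @picard R (fun _ y => C y - 1)
  (fun x y => n * C y - k * C y ^+ 2 - lam * expR (2 * Num.min x c)) L B 0 beta L0.
- move=> x y x' y'; have -> : C y - 1 - (C y' - 1) = C y - C y' by ring.
  apply: le_trans (clamp_lipschitz _ _ _ _) _.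
  apply: (@le_trans _ _ (1 * (`|x - x'| + `|y - y'|))); first by rewrite mul1r lerDr.
  by apply: ler_wpM2r; rewrite ?addr_ge0 // /L; lra.
- move=> x y x' y'.
  have -> : n * C y - k * C y ^+ 2 - lam * expR (2 * Num.min x c) -
    (n * C y' - k * C y' ^+ 2 - lam * expR (2 * Num.min x' c)) =
    n * (C y - C y') - k * ((C y + C y') * (C y - C y'))
    - lam * (expR (2 * Num.min x c) - expR (2 * Num.min x' c)) by ring.
  apply: le_trans (ler_normB _ _) _; apply: le_trans (lerD (ler_normB _ _) (lexx _)) _.
  rewrite !normrM.
  have dy := clamp_lipschitz a b y y'; have dx := expR_min_lipschitz c x x'.
  rewrite -/C -/e in dy dx.
  have h1 := ler_wpM2l L1 dy.
  have h2 : `|C y + C y'| * `|C y - C y'| <= 2 * m * `|y - y'|.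
    apply: ler_pM => //; apply: le_trans (ler_normD _ _) _.
    have := Cm y; have := Cm y'; lra.
  have h2' := ler_wpM2l (normr_ge0 k) h2.
  have h3 := ler_wpM2l (normr_ge0 lam) dx.
  have p1 := mulr_ge0 L1 (normr_ge0 (x - x')).
  have p2 := mulr_ge0 L2 (normr_ge0 (x - x')).
  have p3 := mulr_ge0 L3 (normr_ge0 (y - y')).
  have p4 := normr_ge0 (x - x'). have p5 := normr_ge0 (y - y').
  by rewrite /L; lra.
- move=> x y; apply: le_trans (ler_normB _ _) _.
  by have := Cm y; rewrite normr1 /B; lra.
- move=> x y; apply: le_trans (ler_normB _ _) _.
  apply: le_trans (lerD (ler_normB _ _) (lexx _)) _; rewrite (normrM n) (normrM k) (normrM lam) normrX.
  have h1 := ler_wpM2l L1 (Cm y).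
  have h2 : `|C y| ^+ 2 <= m ^+ 2 by rewrite lerXn2r ?nnegrE.
  have h2' := ler_wpM2l (normr_ge0 k) h2.
  have h3 := ler_wpM2l (normr_ge0 lam) (ec x).
  by rewrite /B; lra.
by move=> l [q [l0 q0 dl dq]]; exists l, q.
Qed.

End Truncation.

(** * The autonomous system *)

Section Flow.
Context {R : realType}.
Implicit Types (l q : R -> R) (n k m lam beta s : R).

(* With [s = - ln r], [w = 1 - u], the unknowns are [q = r w' / w] and
   [l = - ln (w / r)]; here [n = N - 2] and [k = delta - 1]. *)
Definition flow n k lam beta l q : Prop := [/\ l 0 = 0, q 0 = beta,
  forall s, 0 <= s -> is_derive s 1 l (q s - 1)
& forall s, 0 <= s ->
    is_derive s 1 q (n * q s - k * q s ^+ 2 - lam * expR (2 * l s))].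

(* [s + l s = - ln w], so that the last condition says that [w] vanishes at [r = 0]. *)
Definition rupture_flow n k lam beta l q : Prop := [/\ flow n k lam beta l q,
  forall s, 0 <= s -> 0 < q s & forall M, exists2 s, 0 <= s & M <= s + l s].

Lemma flow_of_truncated n k lam beta a b c l q : l 0 = 0 -> q 0 = beta ->
  (forall s, 0 <= s -> is_derive s 1 l (clamp a b (q s) - 1)) ->
  (forall s, 0 <= s -> is_derive s 1 q
    (n * clamp a b (q s) - k * clamp a b (q s) ^+ 2 - lam * expR (2 * Num.min (l s) c))) ->
  (forall s, 0 <= s -> a <= q s <= b) -> (forall s, 0 <= s -> l s <= c) ->
  flow n k lam beta l q.
Proof.
move=> l0 q0 dl dq qab lc; split => // s s0.
  by have := dl s s0; rewrite clamp_id ?qab.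
by have := dq s s0; rewrite clamp_id ?qab // min_l ?lc.
Qed.

(** The derivative of [s + l s] is [q s], so this quantity grows at least linearly. *)
Lemma flow_unbounded n k lam beta l q (kap : R) : flow n k lam beta l q -> 0 < kap ->
  (forall s, 0 <= s -> kap <= q s) -> forall M, exists2 s, 0 <= s & M <= s + l s.
Proof.
move=> [l0 _ dl _] kap0 hq M.
have H s : 0 <= s -> kap * s <= s + l s.
  apply: (@is_derive_le _ (fun s => kap * s) (fun=> kap) (fun s => s + l s) q) => //.
  - by rewrite l0; lra.
  - by move=> t t0; derive_tac; ring.
  - by move=> t t0; have := dl t t0 => ?; derive_tac; ring.
exists (`|M| / kap); first by rewrite divr_ge0 // ltW.
apply: le_trans (H _ _); last by rewrite divr_ge0 // ltW.
by rewrite mulrC divfK ?gt_eqF // ler_norm.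
Qed.

(** Here [q] has no evident constant lower bound. The barrier [a / (1 + s)] works because its slope
    [- a / (1 + s) ^ 2] absorbs [k * q ^ 2] and the exponentially small [X]; its integral still
    diverges, logarithmically. *)
Lemma rupture_flow_plane k lam beta : 0 <= k -> 4^-1 < beta < 2^-1 ->
  0 < lam < (32 * (k + 1))^-1 -> exists l q, rupture_flow 0 k lam beta l q.
Proof.
move=> k0 /andP[b1 b2] /andP[lam0 lam1].
have b0 : 0 <= beta by lra.
have [l [q [l0 q0 dl dq]]] := truncated_flow 0 k lam 0 beta b0.
have Qin s := @clamp_in _ 0 beta (q s) b0.
have X0 s : 0 <= lam * expR (2 * Num.min (l s) 0) by rewrite mulr_ge0 ?expR_ge0 // ltW.
have kQ s : 0 <= k * clamp 0 beta (q s) ^+ 2 by rewrite mulr_ge0 // sqr_ge0.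
have ls s : 0 <= s -> l s <= - 2^-1 * s.
  apply: (@is_derive_le _ l (fun s => clamp 0 beta (q s) - 1) (fun s => - 2^-1 * s) (fun=> - 2^-1)) => //.
  - by rewrite l0; lra.
  - by move=> t t0; derive_tac; ring.
  - by move=> t t0; have /andP[_ h] := Qin t; lra.
have qb s : 0 <= s -> q s <= beta.
  apply: (@is_derive_le _ q _ (fun=> beta) (fun=> 0) _ dq) => //.
  - by rewrite q0.
  - by move=> t t0; have := X0 t; have := kQ t; lra.
(* This [a] starts below [beta], satisfies [k * a ^ 2 <= a / 4], and leaves room for
   [4 * lam < a / 2]. *)
pose a := (4 * (k + 1))^-1.
have k1 : 0 < k + 1 by lra.
have a0 : 0 < a by rewrite invr_gt0; lra.
have ak : a * (k + 1) = 4^-1 by rewrite /a; field; rewrite gt_eqF //; lra.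
have a4 : a <= 4^-1 by have := mulr_ge0 (ltW a0) k0; lra.
have lam4 : 8 * lam < a.
  have -> : a = 8 * (32 * (k + 1))^-1 by rewrite /a; field; rewrite gt_eqF //; lra.
  by lra.
have qa s : 0 <= s -> 0 <= q s - a * (1 + s)^-1.
  apply: (@barrier _ (fun s => q s - a * (1 + s)^-1)
    (fun s => 0 * clamp 0 beta (q s) - k * clamp 0 beta (q s) ^+ 2
      - lam * expR (2 * Num.min (l s) 0) + a * (1 + s) ^- 2) 1); first by [].
  - by rewrite q0 addr0 invr1; lra.
  - move=> t t0; have := dq t t0 => ?.
    have : is_derive t 1 (fun s => (1 + s)^-1) (- (1 + t) ^- 2 * (0 + 1)).
      by apply: is_derive_fV; rewrite gt_eqF //; lra.
    by move=> ?; derive_tac; ring.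
  move=> t t0 _ ft.
  have t1 : 0 < 1 + t by lra.
  pose y := (1 + t)^-1.
  have y0 : 0 < y by rewrite invr_gt0.
  have -> : (1 + t) ^- 2 = y ^+ 2 by rewrite /y exprVn.
  have hQ : clamp 0 beta (q t) <= a * y.
    rewrite /clamp ge_max ge_min; apply/andP; split; last by rewrite mulr_ge0 // ltW.
    by apply/orP; left; move: ft; rewrite -/y; lra.
  have hQ2 : clamp 0 beta (q t) ^+ 2 <= (a * y) ^+ 2.
    by have /andP[h _] := Qin t; rewrite lerXn2r // nnegrE // mulr_ge0 // ltW.
  (* From [l t <= - t / 2], the exponential is at most [expR (- t)], and
     [expR (t / 2) >= (1 + t) / 2] is squared. *)
  have hX : expR (2 * Num.min (l t) 0) <= 4 * y ^+ 2.
    have lt0 := ls t t0.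
    apply: (@le_trans _ _ (expR (- t))).
      by rewrite ler_expR min_l; lra.
    rewrite expRN -[X in expR X](_ : t / 2 + t / 2 = t); last by field.
    rewrite expRD; have h := expR_ge1Dx (t / 2).
    have h2 : (1 + t) / 2 <= expR (t / 2) by lra.
    have h3 : ((1 + t) / 2) ^+ 2 <= expR (t / 2) * expR (t / 2).
      by rewrite -expr2 lerXn2r // nnegrE ?expR_ge0 //; lra.
    have -> : 4 * y ^+ 2 = (((1 + t) / 2) ^+ 2)^-1 by rewrite /y; field; rewrite gt_eqF.
    by rewrite lef_pV2 // posrE ?exprn_gt0 ?mulr_gt0 ?expR_gt0.
  have h1 := ler_wpM2l k0 hQ2; have h2 := ler_wpM2l (ltW lam0) hX.
  suff : 0 <= (a - k * a ^+ 2 - 4 * lam) * y ^+ 2 by lra.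
  apply: mulr_ge0 (sqr_ge0 _).
  have : a * (a * (k + 1)) <= a * 4^-1 by rewrite ak.
  have := mulr_ge0 (ltW a0) (ltW a0); lra.
have apos s : 0 <= s -> 0 < a * (1 + s)^-1.
  by move=> s0; rewrite mulr_gt0 // invr_gt0; lra.
have hf : flow 0 k lam beta l q.
  apply: (@flow_of_truncated _ _ _ _ 0 beta 0) => // s s0; last by have := ls s s0; lra.
  by rewrite qb // andbT; have := qa s s0; have := apos s s0; lra.
exists l, q; split => //.
- by move=> s s0; have := qa s s0; have := apos s s0; lra.
have [_ _ dl' _] := hf.
have H s : 0 <= s -> a * ln (1 + s) <= s + l s.
  apply: (@is_derive_le _ (fun s => a * ln (1 + s)) (fun s => a * (1 + s)^-1)
    (fun s => s + l s) q).
  - by rewrite addr0 ln1 l0; lra.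
  - move=> t t0.
    have : is_derive t 1 (fun s => ln (1 + s)) ((1 + t)^-1 * (0 + 1)).
      by apply: is_derive_fln; lra.
    by move=> ?; derive_tac; ring.
  - by move=> t t0; have := dl' t t0 => ?; derive_tac; ring.
  - by move=> t t0; have := qa t t0; lra.
move=> M; have s0 : 0 <= expR (`|M| / a) - 1.
  by rewrite subr_ge0 -expR0 ler_expR divr_ge0 // ltW.
(* The time at which [a * ln (1 + s)] equals the absolute value of [M]. *)
exists (expR (`|M| / a) - 1) => //; apply: le_trans (H _ s0).
by rewrite addrC subrK expRK mulrC divfK ?gt_eqF // ler_norm.
Qed.

(** On the side [q = n / k] the polynomial part vanishes and [- X] points inwards. On the side
    [q = kap] it is at least [lam], hence at least [X], because [n / k <= 1] keeps [l]
    nonpositive. *)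
Lemma rupture_flow_box n k lam beta (kap : R) : 0 < k -> 0 <= n <= k -> 0 < kap ->
  kap <= beta <= n / k -> 0 < lam <= n * kap - k * kap ^+ 2 ->
  exists l q, rupture_flow n k lam beta l q.
Proof.
move=> k0 /andP[n0 nk] kap0 /andP[b1 b2] /andP[lam0 lam1].
pose b := n / k; have kb : k * b = n by rewrite mulrC divfK // gt_eqF.
have kapb : kap <= b by exact: le_trans b2.
have b1' : b <= 1 by rewrite ler_pdivrMr // mul1r.
have [l [q [l0 q0 dl dq]]] := truncated_flow n k lam 0 beta kapb.
have Qin s := @clamp_in _ kap b (q s) kapb.
have X0 s : 0 <= lam * expR (2 * Num.min (l s) 0) by rewrite mulr_ge0 ?expR_ge0 // ltW.
have Xl s : lam * expR (2 * Num.min (l s) 0) <= lam.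
  rewrite ger_pMr // expR_le1.
  have : Num.min (l s) 0 <= 0 by rewrite ge_min lexx orbT.
  by lra.
have ls s : 0 <= s -> l s <= 0.
  apply: (@is_derive_le _ l _ (fun=> 0) (fun=> 0) _ dl) => //.
  - by rewrite l0.
  - by move=> t t0; have /andP[_ h] := Qin t; lra.
pose dQ s := n * clamp kap b (q s) - k * clamp kap b (q s) ^+ 2
  - lam * expR (2 * Num.min (l s) 0).
have qlo s : 0 <= s -> 0 <= q s - kap.
  apply: (@barrier _ (fun s => q s - kap) dQ 1); first by [].
  - by rewrite q0; lra.
  - by move=> t t0; have := dq t t0 => ?; derive_tac; rewrite addr0.
  move=> t t0 _ ft; rewrite /dQ /clamp max_r; first by have := Xl t; lra.
  by rewrite ge_min; apply/orP; left; lra.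
have qhi s : 0 <= s -> 0 <= b - q s.
  apply: (@barrier _ (fun s => b - q s) (fun s => - dQ s) 1); first by [].
  - by rewrite q0; move: b2; rewrite -/b; lra.
  - by move=> t t0; have := dq t t0 => ?; derive_tac; rewrite add0r.
  move=> t t0 _ ft; have qb : b <= q t by lra.
  rewrite /dQ /clamp (min_r qb) (max_l kapb); have := X0 t.
  have -> : n * b - k * b ^+ 2 = 0 by rewrite -kb; ring.
  by lra.
have hf : flow n k lam beta l q.
  apply: (@flow_of_truncated _ _ _ _ kap b 0) => // s s0.
  by have := qlo s s0; have := qhi s s0; rewrite !subr_ge0 => -> ->.
exists l, q; split => //.
- by move=> s s0; have := qlo s s0; lra.
- by apply: (flow_unbounded hf kap0) => s s0; have := qlo s s0; lra.
Qed.

Lemma exists_expR (x : R) : 0 < x -> exists c, expR (2 * c) = x.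
Proof.
by move=> x0; exists (ln x / 2); rewrite mulrC divfK // lnK // posrE.
Qed.

(** For [n = k = 0] the quantity [(q - 1) ^ 2 + X] is a first integral; a value below [1] confines
    [q] to []0, 2[] and [X] below [1]. *)
Lemma rupture_flow_conservative lam beta : 0 < lam -> (beta - 1) ^+ 2 + lam < 1 ->
  exists l q, rupture_flow 0 0 lam beta l q.
Proof.
move=> lam0 hb.
(* The cap [c] is the level of [l] at which [X] reaches [1]. *)
have [|c cE] := @exists_expR lam^-1; first by rewrite invr_gt0.
have [l [q [l0 q0 dl dq]]] := truncated_flow 0 0 lam c beta (ler0n _ 2).
pose A := (beta - 1) ^+ 2 + lam.
pose P s := (q s - 1) ^+ 2 + lam * expR (2 * l s).
have inner s : P s < 1 -> (0 <= q s <= 2) /\ l s <= c.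
  rewrite /P => hP; have h0 : 0 < expR (2 * l s) by exact: expR_gt0.
  have h1 := mulr_gt0 lam0 h0; have h2 := sqr_ge0 (q s - 1).
  have h3 : (q s - 1) ^+ 2 < 1 by lra.
  have : `|q s - 1| < 1 by rewrite -(@ltr_pXn2r _ 2) ?nnegrE // real_normK ?num_real // expr1n.
  rewrite ltr_norml => /andP[h4 h5]; split; first by apply/andP; split; lra.
  suff : expR (2 * l s) <= expR (2 * c) by rewrite ler_expR; lra.
  by rewrite cE -[lam^-1]mulr1 ler_pdivlMl //; lra.
have PA s : 0 <= s -> 0 <= A - P s.
  (* In a layer of width [1 - A] one still has [P < 1], so the truncations are inactive and the
     derivative of [P] is zero. *)
  apply: (@barrier _ (fun s => A - P s) (fun s => - (2 * (q s - 1) *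
     (0 * clamp 0 2 (q s) - 0 * clamp 0 2 (q s) ^+ 2 - lam * expR (2 * Num.min (l s) c))
     + lam * (expR (2 * l s) * (2 * (clamp 0 2 (q s) - 1))))) (1 - A)).
  - by rewrite subr_gt0.
  - by rewrite /A /P l0 q0 mulr0 expR0; lra.
  - move=> t t0; have := dq t t0; have := dl t t0 => ? ?.
    by rewrite /P; derive_tac; ring.
  move=> t t0 hP _; have /inner[h1 h2] : P t < 1 by lra.
  by rewrite clamp_id // min_l // le_eqVlt; apply/orP; left; apply/eqP; ring.
have in1 s : 0 <= s -> (0 <= q s <= 2) /\ l s <= c.
  by move=> s0; apply: inner; have := PA s s0; rewrite /A; lra.
have hf : flow 0 0 lam beta l q.
  by apply: (@flow_of_truncated _ _ _ _ 0 2 c) => // s /in1[].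
(* Expanding the square in [P s <= A] gives [2 * q >= 1 - A + q ^ 2 + X]. *)
have qlo s : 0 <= s -> (1 - A) / 2 <= q s.
  move=> s0; have := PA s s0; rewrite /P.
  have := mulr_gt0 lam0 (expR_gt0 (2 * l s)); have := sqr_ge0 (q s).
  lra.
have A1 : 0 < (1 - A) / 2 by rewrite /A; lra.
exists l, q; split => //; last exact: (flow_unbounded hf A1).
by move=> s s0; apply: lt_le_trans (qlo s s0).
Qed.

(* Energy of the Emden-Fowler variable [v * r ^ k], [v = w ^ (- 1 / k)], up to a constant. *)
Definition energy k m lam l q s : R :=
  ((q s - 1) ^+ 2 + lam * expR (2 * l s) / (k + 1) - m / k) * expR (2 * k * l s).

(** The weight [1 / (k + 1)] makes all terms in [X] cancel. What remains is damping when [m < k],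
    and conservation when [m = k]. *)
Lemma is_derive_energy k m lam l q s : 0 < k ->
  is_derive s 1 l (q s - 1) ->
  is_derive s 1 q ((k + m) * q s - k * q s ^+ 2 - lam * expR (2 * l s)) ->
  is_derive s 1 (energy k m lam l q)
    (- (2 * (k - m) * (q s - 1) ^+ 2 * expR (2 * k * l s))).
Proof.
move=> k0 dl dq; rewrite /energy; derive_tac; field.
by rewrite !gt_eqF //; lra.
Qed.

(** The exponential factor is positive, so the bracket is negative and each of its two nonnegative
    terms is below [m / k], itself at most [1]. *)
Lemma energy_inner k m lam l q s : 0 < lam -> 0 < m <= k -> energy k m lam l q s < 0 ->
  (q s - 1) ^+ 2 < 1 /\ lam * expR (2 * l s) < (k + 1) * m / k.
Proof.
move=> lam0 /andP[m0 mk]; have k0 : 0 < k by apply: lt_le_trans mk.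
have k1 : 0 < k + 1 by lra.
have mk1 : m / k <= 1 by rewrite ler_pdivrMr // mul1r.
rewrite /energy pmulr_llt0 ?expR_gt0 // => h.
have h0 := divr_gt0 (mulr_gt0 lam0 (expR_gt0 (2 * l s))) k1.
have h1 := sqr_ge0 (q s - 1).
split; first by lra.
by rewrite -mulrA [ltRHS]mulrC -ltr_pdivrMr //; lra.
Qed.

(** Since [l 0 = 0], the assumption on [beta] says that the energy starts negative. It never
    increases, and negative energy confines the trajectory. *)
Lemma rupture_flow_energy k m lam beta : 0 < lam -> 0 < m <= k ->
  (beta - 1) ^+ 2 + lam / (k + 1) < m / k ->
  exists l q, [/\ rupture_flow (k + m) k lam beta l q,
    forall s, 0 <= s -> energy k m lam l q s < 0
  & exists c, forall s, 0 <= s -> c <= l s].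
Proof.
move=> lam0 mk hb; have /andP[m0 mk'] := mk.
have k0 : 0 < k by apply: lt_le_trans mk'.
have k1 : 0 < k + 1 by lra.
have [|c cE] := @exists_expR ((k + 1) * m / k / lam).
  by rewrite !divr_gt0 // mulr_gt0.
have [l [q [l0 q0 dl dq]]] := truncated_flow (k + m) k lam c beta (ler0n _ 2).
have inner s : energy k m lam l q s < 0 -> (0 <= q s <= 2) /\ l s <= c.
  move=> /(energy_inner lam0 mk)[h1 h2].
  have : `|q s - 1| < 1 by rewrite -(@ltr_pXn2r _ 2) ?nnegrE // real_normK ?num_real // expr1n.
  rewrite ltr_norml => /andP[h4 h5]; split; first by apply/andP; split; lra.
  suff : expR (2 * l s) <= expR (2 * c) by rewrite ler_expR; lra.
  by rewrite cE ler_pdivlMr // mulrC ltW.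
pose E0 := energy k m lam l q 0.
have E00 : E0 < 0.
  by rewrite /E0 /energy l0 q0 !mulr0 expR0 !mulr1 subr_lt0.
(* The layer has width [- E0]: inside it the energy is still negative, hence the truncations are
   inactive. *)
have EE s : 0 <= s -> 0 <= E0 - energy k m lam l q s.
  pose dQ s := 2 * (q s - 1) * ((k + m) * clamp 0 2 (q s) - k * clamp 0 2 (q s) ^+ 2
       - lam * expR (2 * Num.min (l s) c))
     + lam * (expR (2 * l s) * (2 * (clamp 0 2 (q s) - 1))) / (k + 1).
  apply: (@barrier _ (fun s => E0 - energy k m lam l q s) (fun s => -
    (dQ s * expR (2 * k * l s)
     + ((q s - 1) ^+ 2 + lam * expR (2 * l s) / (k + 1) - m / k) *
        (expR (2 * k * l s) * (2 * k * (clamp 0 2 (q s) - 1))))) (- E0)).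
  - by rewrite oppr_gt0.
  - by rewrite subrr.
  - move=> t t0; have := dq t t0; have := dl t t0 => ? ?.
    by rewrite /energy /dQ; derive_tac; ring.
  move=> t t0 hP _; have /inner[h1 h2] : energy k m lam l q t < 0 by lra.
  rewrite /dQ clamp_id // min_l //.
  rewrite [X in 0 <= X](_ : _ = 2 * (k - m) * (q t - 1) ^+ 2 * expR (2 * k * l t)).
    by rewrite mulr_ge0 ?expR_ge0 // mulr_ge0 ?sqr_ge0 // mulr_ge0 // subr_ge0.
  by field; rewrite !gt_eqF //; lra.
have En s : 0 <= s -> energy k m lam l q s < 0.
  by move=> s0; apply: le_lt_trans E00; rewrite -subr_ge0 EE.
have hf : flow (k + m) k lam beta l q.
  by apply: (@flow_of_truncated _ _ _ _ 0 2 c) => // s /En /inner[].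
(* The energy is at most [E0 < 0] and at least [- (m / k) * expR (2 * k * l s)], which prevents [l]
   from tending to [-oo]. *)
have lo : exists c, forall s, 0 <= s -> c <= l s.
  pose y := - E0 * k / m.
  have y0 : 0 < y by rewrite divr_gt0 // mulr_gt0 // oppr_gt0.
  exists (ln y / (2 * k)) => s s0.
  rewrite ler_pdivrMr; last by lra.
  rewrite -ler_expR lnK ?posrE // mulrC /y ler_pdivrMr // -ler_pdivlMr //.
  have := EE s s0; rewrite /energy.
  have := mulr_ge0 (sqr_ge0 (q s - 1)) (expR_ge0 (2 * k * l s)).
  have h2 : 0 <= lam * expR (2 * l s) / (k + 1).
    by rewrite divr_ge0 ?mulr_ge0 ?expR_ge0 // ltW.
  have := mulr_ge0 h2 (expR_ge0 (2 * k * l s)); lra.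
exists l, q; split => //; split => //.
- move=> s s0; have [h _] := energy_inner lam0 mk (En s s0).
  have := sqr_ge0 (q s); lra.
- move=> M; have [d hd] := lo; exists (`|M - d|) => //.
  by have := hd `|M - d| (normr_ge0 _); have := ler_norm (M - d); lra.
Qed.

End Flow.

(** * Radial functions *)

Section RadialCalculus.
Context {R : realType} {N : nat}.
Implicit Types (x y v : 'rV[R]_N) (i j : 'I_N) (U f : 'rV[R]_N -> R) (g : R -> R).

(** Both difference quotients are the same function of [h]. *)
Lemma is_derive_line f x v (d : R) :
  is_derive (0 : R) 1 (fun h : R => f (h *: v + x)) d -> is_derive x v f d.
Proof.
have E : (fun h : R => h^-1 *: (((fun h => f (h *: v + x)) \o shift 0) (h *: 1) - f (0 *: v + x)))
  = (fun h : R => h^-1 *: ((f \o shift x) (h *: v) - f x)).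
  by apply/funext => h /=; rewrite scale0r add0r addr0 [h *: 1]mulr1.
by case; rewrite /derivable /derive E; split.
Qed.

(** Radial functions are differentiated as functions of [t = r ^ 2], a polynomial in the
    coordinates, which avoids derivatives of the square root. *)
Definition sqr_enorm x : R := \sum_(i < N) x 0 i ^+ 2.

Lemma enormE x : enorm x = Num.sqrt (sqr_enorm x). Proof. by []. Qed.

Lemma sqr_enorm_ge0 x : 0 <= sqr_enorm x.
Proof. by apply: sumr_ge0 => i _; rewrite sqr_ge0. Qed.

Lemma sqr_enorm_gt0 x : (0 < sqr_enorm x) = (x != 0).
Proof.
rewrite lt_neqAle sqr_enorm_ge0 andbT; congr (~~ _); rewrite eq_sym.
rewrite psumr_eq0 => [|i _]; last exact: sqr_ge0.
apply/allP/eqP => [h|-> i _]; last by rewrite mxE expr0n eqxx.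
apply/rowP => i; rewrite mxE; apply/eqP; rewrite -sqrf_eq0.
by apply: (implyP (h i _)); rewrite ?mem_index_enum.
Qed.

Lemma sqr_enorm_line x i (h : R) :
  sqr_enorm (h *: delta_mx 0 i + x) = sqr_enorm x + 2 * x 0 i * h + h ^+ 2.
Proof.
rewrite /sqr_enorm (bigD1 i) //= [in RHS](bigD1 i) //=.
rewrite !mxE !eqxx mulr1 (eq_bigr (fun j => x 0 j ^+ 2)); first by ring.
by move=> j ji; rewrite !mxE (negbTE ji) andbF mulr0 add0r.
Qed.

Lemma sqr_enorm_continuous : continuous sqr_enorm.
Proof.
move=> x; rewrite /sqr_enorm; elim: (index_enum _) => [|i r IH].
  rewrite (_ : (fun y => _) = cst 0); first exact: cst_continuous.
  by apply/funext => y; rewrite big_nil.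
rewrite (_ : (fun y => _) =
    (fun y : 'rV_N => y 0 i * y 0 i + \sum_(j <- r) y 0 j ^+ 2)); last first.
  by apply/funext => y; rewrite big_cons expr2.
by apply: continuousD IH; apply: continuousM; exact: coord_continuous.
Qed.

Lemma is_derive_coord x i j : is_derive x (delta_mx 0 j) (fun y => y 0 i) (i == j)%:R.
Proof.
apply: is_derive_line; rewrite (_ : (fun h : R => _) = (fun h : R => h * (i == j)%:R + x 0 i)).
  by derive_tac; ring.
by apply/funext => h; rewrite !mxE eqxx.
Qed.

Lemma is_derive_radial g x j (d : R) : is_derive (sqr_enorm x) 1 g d ->
  is_derive x (delta_mx 0 j) (fun y => g (sqr_enorm y)) (2 * x 0 j * d).
Proof.
move=> gd; apply: is_derive_line.
pose p (h : R) := sqr_enorm x + 2 * x 0 j * h + h ^+ 2.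
have -> : (fun h : R => g (sqr_enorm (h *: delta_mx 0 j + x))) = g \o p.
  by apply/funext => h /=; rewrite sqr_enorm_line.
have p0 : p 0 = sqr_enorm x by rewrite /p; ring.
have dp : is_derive (0 : R) 1 p (2 * x 0 j) by rewrite /p; derive_tac; ring.
rewrite -p0 in gd; have h := is_derive1_comp gd dp.
by apply: is_derive_eq; rewrite mulrC.
Qed.

Definition punctured : set 'rV[R]_N := [set x | 0 < sqr_enorm x < 1].

Lemma punctured_ballE : punctured_ball = punctured.
Proof.
apply/seteqP; split => x.
  move=> [x1 x0]; rewrite /punctured /= sqr_enorm_gt0; apply/andP; split.
    by apply/eqP.
  by move: x1; rewrite /unit_ball /= enormE -{1}sqrtr1 ltr_sqrt.
rewrite /punctured /= sqr_enorm_gt0 => /andP[/eqP x0 x1]; split => //.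
by rewrite /unit_ball /= enormE -sqrtr1 ltr_sqrt.
Qed.

Lemma punctured_near x : punctured x -> \forall y \near x, punctured y.
Proof.
move=> /andP[x0 x1]; near=> y; apply/andP; split.
  by near: y; apply: (cvgr_gt _ (@sqr_enorm_continuous x)).
by near: y; apply: (cvgr_lt _ (@sqr_enorm_continuous x)).
Unshelve. all: end_near. Qed.

(** * Second-order calculus for functions of the squared radius *)

Section SecondOrder.
Variables (U : 'rV[R]_N -> R) (g g1 g2 : R -> R).
Hypothesis Ug : forall x, punctured x -> U x = g (sqr_enorm x).
Hypothesis dg : forall t : R, 0 < t < 1 -> is_derive t 1 g (g1 t).
Hypothesis dg1 : forall t : R, 0 < t < 1 -> is_derive t 1 g1 (g2 t).
Hypothesis cg2 : forall t : R, 0 < t < 1 -> {for t, continuous g2}.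

Let is_derive_U x i : punctured x ->
  is_derive x (delta_mx 0 i) U (2 * x 0 i * g1 (sqr_enorm x)).
Proof.
move=> hx; apply: (@near_eq_is_derive _ _ _ (fun y => g (sqr_enorm y))).
  by apply: filterS (punctured_near hx) => y /Ug.
by apply: is_derive_radial; apply: dg.
Qed.

Let partialE x i : punctured x -> partial i U x = 2 * x 0 i * g1 (sqr_enorm x).
Proof. by move=> hx; apply: derive_val; apply: is_derive_U. Qed.

Let is_derive_partial x i j : punctured x -> is_derive x (delta_mx 0 j) (partial i U)
  (2 * (i == j)%:R * g1 (sqr_enorm x) + 4 * x 0 i * x 0 j * g2 (sqr_enorm x)).
Proof.
move=> hx.
apply: (@near_eq_is_derive _ _ _ ((fun y => 2 * y 0 i) * (fun y => g1 (sqr_enorm y)))).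
  by apply: filterS (punctured_near hx) => y /partialE ->.
have h1 := is_derive_radial j (dg1 hx).
have h2 : is_derive x (delta_mx 0 j) (fun y => 2 * y 0 i) (2 * (i == j)%:R).
  exact: (@is_deriveZ _ _ _ (fun y : 'rV_N => y 0 i : R) 2 x _ _ (is_derive_coord x i j)).
have h3 := is_deriveM h2 h1; apply: is_derive_eq h3 _.
by rewrite /GRing.scale /=; ring.
Qed.

Let partial2E x i j : punctured x -> partial j (partial i U) x =
  2 * (i == j)%:R * g1 (sqr_enorm x) + 4 * x 0 i * x 0 j * g2 (sqr_enorm x).
Proof. by move=> hx; apply: derive_val; apply: is_derive_partial. Qed.

Let continuous_radial (f : R -> R) x : {for sqr_enorm x, continuous f} ->
  {for x, continuous (fun y => f (sqr_enorm y))}.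
Proof. by move=> cf; apply: (continuous_comp (@sqr_enorm_continuous x) cf). Qed.

Let near_continuous f1 f2 x : (forall y, punctured y -> f1 y = f2 y) -> punctured x ->
  {for x, continuous f2} -> {for x, continuous f1}.
Proof.
move=> f12 hx cf2; rewrite /prop_for /continuous_at f12 //.
apply: cvg_trans cf2; apply: (@near_eq_cvg _ _ (nbhs x)).
by near=> y; rewrite f12 //; near: y; exact: punctured_near.
Unshelve. all: end_near. Qed.

Lemma radial_C2 : C2_on punctured U.
Proof.
have cc (c : R) x i : {for x, continuous (fun y : 'rV[R]_N => c * y 0 i)}.
  by apply: continuousM; [exact: cst_continuous | exact: coord_continuous].
move=> x hx i j; split.
- by case: (is_derive_U i hx).
- apply: (near_continuous (fun y hy => partialE i hy) hx).
  apply: continuousM; first exact: cc.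
  by apply: continuous_radial; exact: is_derive_cvg (dg1 hx).
- by case: (is_derive_partial i j hx).
- apply: (near_continuous (fun y hy => partial2E i j hy) hx).
  apply: continuousD; apply: continuousM.
  + exact: cst_continuous.
  + by apply: continuous_radial; exact: is_derive_cvg (dg1 hx).
  + by apply: continuousM; [exact: cc | exact: coord_continuous].
  + by apply: continuous_radial; exact: cg2.
Qed.

Lemma radial_laplacian x : punctured x -> laplacian U x =
  2 * N%:R * g1 (sqr_enorm x) + 4 * sqr_enorm x * g2 (sqr_enorm x).
Proof.
move=> hx; rewrite /laplacian.
rewrite (eq_bigr (fun i => 2 * g1 (sqr_enorm x) + 4 * g2 (sqr_enorm x) * x 0 i ^+ 2)).
  rewrite big_split /= sumr_const card_ord -mulr_sumr -/(sqr_enorm x).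
  by ring.
by move=> i _; rewrite partial2E // eqxx /=; ring.
Qed.

Lemma radial_grad_sqr x : punctured x ->
  grad_sqr U x = 4 * sqr_enorm x * g1 (sqr_enorm x) ^+ 2.
Proof.
move=> hx; rewrite /grad_sqr.
rewrite (eq_bigr (fun i => 4 * g1 (sqr_enorm x) ^+ 2 * x 0 i ^+ 2)).
  by rewrite -mulr_sumr -/(sqr_enorm x); ring.
by move=> i _; rewrite partialE //; ring.
Qed.

End SecondOrder.

End RadialCalculus.

(** * From trajectories to rupture solutions *)

Section Profile.
Context {R : realType}.
Implicit Types (l q u : R -> R) (n k lam beta r s : R).

(* At [r = 0] the value is [1], whatever [ln 0] is. *)
Definition profile l r : R := 1 - r * expR (- l (- ln r)).

Lemma profile_gt0 l r : 0 < r -> profile l r = 1 - expR (- (- ln r + l (- ln r))).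
Proof. by move=> r0; rewrite /profile opprD expRD opprK lnK ?posrE. Qed.

Lemma ln_sqrt (t : R) : 0 < t -> ln (Num.sqrt t) = ln t / 2.
Proof.
move=> t0; have s0 : 0 < Num.sqrt t by rewrite sqrtr_gt0.
by rewrite -{2}(sqr_sqrtr (ltW t0)) lnXn // mulr2n; field.
Qed.

Section Solution.
Variables (N : nat) (delta lam beta : R) (l q : R -> R).
Hypothesis lq : rupture_flow (N%:R - 2) (delta - 1) lam beta l q.

Let l0 : l 0 = 0. Proof. by have [[]] := lq. Qed.
Let dl s : 0 <= s -> is_derive s 1 l (q s - 1).
Proof. by have [[_ _ h _] _ _] := lq; apply: h. Qed.
Let dq s : 0 <= s -> is_derive s 1 q
  ((N%:R - 2) * q s - (delta - 1) * q s ^+ 2 - lam * expR (2 * l s)).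
Proof. by have [[_ _ _ h] _ _] := lq; apply: h. Qed.
Let q_gt0 s : 0 <= s -> 0 < q s. Proof. by have [_ h _] := lq; apply: h. Qed.

Let dh s : 0 <= s -> is_derive s 1 (fun s => s + l s) (q s).
Proof. by move=> s0; have := dl s0 => ?; derive_tac; ring. Qed.

Let h_le s t : 0 <= s -> s <= t -> s + l s <= t + l t.
Proof.
move=> s0 st; apply: (@ge0_derive_homo _ (fun s => s + l s) q) => // x /andP[sx _].
  exact/dh/(le_trans s0).
exact/ltW/q_gt0/(le_trans s0)/ltW.
Qed.

(** Strictness here gives [u > 0] inside the ball. *)
Let h_gt0 s : 0 < s -> 0 < s + l s.
Proof.
move=> s0; have [||c] := @MVT R (fun s => s + l s) q 0 s s0.
- by move=> x; rewrite in_itv /= => /andP[x0 _]; apply/dh/ltW.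
- apply: derivable_within_continuous => x; rewrite in_itv /= => /andP[x0 _].
  by case: (dh x0).
rewrite in_itv /= => /andP[c0 _]; rewrite l0 addr0 subr0 subr0 => ->.
by rewrite mulr_gt0 // q_gt0 // ltW.
Qed.

(** [W] is [w = 1 - u] in the variable [s], and [sg] recovers [s = - ln r] from [t = r ^ 2]. Below,
    [g] is the profile in the variable [t], with derivatives [g1] and [g2]. *)
Let W s := expR (- (s + l s)).

Let sg (t : R) := - ln t / 2.

Let profile_sqrt (t : R) : 0 < t -> profile l (Num.sqrt t) = 1 - W (sg t).
Proof. by move=> t0; rewrite profile_gt0 ?sqrtr_gt0 // ln_sqrt // /W /sg mulNr. Qed.

(** This is the relation [X = lam * r ^ 2 / w ^ 2], used to eliminate the exponential from the
    equation. *)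
Let W_sqr (t : R) : 0 < t -> W (sg t) ^+ 2 * expR (2 * l (sg t)) = t.
Proof.
move=> t0; rewrite expr2 -!expRD -[RHS]lnK ?posrE //; congr expR.
by rewrite /sg; field.
Qed.

Let sg_gt0 (t : R) : 0 < t < 1 -> 0 < sg t.
Proof. by move=> t01; rewrite /sg divr_gt0 // oppr_gt0 ln_lt0. Qed.

Let dsg (t : R) : 0 < t -> is_derive t 1 sg (- (2 * t)^-1).
Proof.
move=> t0; have := is_derive1_ln t0 => ?; rewrite /sg; derive_tac.
by field; rewrite gt_eqF.
Qed.

Let comp_sg f (a t : R) : 0 < t -> is_derive (sg t) 1 f a ->
  is_derive t 1 (fun t => f (sg t)) (- a / (2 * t)).
Proof.
move=> t0 fa; apply: is_derive_eq (is_derive1_comp fa (dsg t0)) _.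
by field; rewrite gt_eqF.
Qed.

Let q' s := (N%:R - 2) * q s - (delta - 1) * q s ^+ 2 - lam * expR (2 * l s).
Let g t := 1 - W (sg t).
Let g1 t := - (q (sg t) * W (sg t)) / (2 * t).
Let g2 t := - (W (sg t) * (q (sg t) ^+ 2 - q' (sg t) - 2 * q (sg t))) / (4 * t ^+ 2).

Let dW s : 0 <= s -> is_derive s 1 W (- (q s * W s)).
Proof. by move=> s0; have := dh s0 => ?; rewrite /W; derive_tac; ring. Qed.

(** The case [t = 1], where [sg t = 0], is included for the sake of continuity up to the sphere. *)
Let dg_pos (t : R) : 0 < t -> 0 <= sg t -> is_derive t 1 g (g1 t).
Proof.
move=> t0 s0; have := comp_sg t0 (dW s0) => ?.
by rewrite /g /g1; derive_tac; ring.
Qed.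

Let dg (t : R) : 0 < t < 1 -> is_derive t 1 g (g1 t).
Proof. by move=> t01; have /andP[t0 _] := t01; apply/(dg_pos t0)/ltW/sg_gt0. Qed.

Let dg1 (t : R) : 0 < t < 1 -> is_derive t 1 g1 (g2 t).
Proof.
move=> t01; have s0 := ltW (sg_gt0 t01); have /andP[t0 _] := t01.
have := comp_sg t0 (dW s0); have := comp_sg t0 (dq s0) => ? ?.
have ? : is_derive t 1 (fun t => (2 * t)^-1) (- (2 * t) ^- 2 * 2).
  apply: is_derive_fV; first by rewrite gt_eqF // mulr_gt0.
  by derive_tac; ring.
rewrite /g1 /g2 /q'; derive_tac.
by field; rewrite gt_eqF.
Qed.

Let cg2 (t : R) : 0 < t < 1 -> {for t, continuous g2}.
Proof.
move=> t01; have s0 := ltW (sg_gt0 t01); have /andP[t0 _] := t01.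
pose G s := - (W s * (q s ^+ 2 - q' s - 2 * q s)).
(* Only continuity is wanted, so the value of the derivative stays implicit. *)
have : exists d, is_derive (sg t) 1 G d.
  have ? := dW s0; have ? := dq s0; have ? := dl s0.
  by rewrite /G /q'; eexists; repeat derive_step.
move=> [d dG].
have h1 := comp_sg t0 dG.
have h2 : is_derive t 1 (fun t => (4 * t ^+ 2)^-1) (- (4 * t ^+ 2) ^- 2 * (8 * t)).
  apply: is_derive_fV; first by rewrite gt_eqF // mulr_gt0 // exprn_gt0.
  by derive_tac; ring.
exact: (is_derive_cvg (is_derive_fM h1 h2)).
Qed.

Let U : 'rV[R]_N -> R := radial_fun (profile l).

Let UE x : 0 < sqr_enorm x -> U x = g (sqr_enorm x).
Proof. by move=> x0; rewrite /U /radial_fun enormE profile_sqrt. Qed.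

Lemma rupture_solution_profile : rupture_solution N delta lam (profile l).
Proof.
have UP x : punctured x -> U x = g (sqr_enorm x) by move=> /andP[x0 _]; apply: UE.
have U0 (x : 'rV[R]_N) : sqr_enorm x = 0 -> U x = 1.
  by move=> x0; rewrite /U /radial_fun enormE x0 sqrtr0 /profile mul0r subr0.
(* Unboundedness of [s + l s] provides one time; monotonicity extends the bound to all later ones.
   This yields continuity at the origin. *)
have W_small (e : R) : 0 < e -> exists2 s, 0 <= s & forall t, s <= t -> W t <= e.
  move=> e0; have [_ _ /(_ (- ln e)) [s s0 hs]] := lq.
  exists s => // t st; rewrite -[leRHS]lnK ?posrE // ler_expR.
  by have := h_le s0 st; lra.
split.
- apply: continuous_in_subspaceT => x; rewrite inE /closed_unit_ball /= => x1.
  have [x0|x0] := eqVneq (sqr_enorm x) 0.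
    apply/(@cvgrPdist_le _ _ _ (nbhs x)) => e e0; rewrite -/U U0 //.
    have [s s0 hs] := W_small e e0.
    have E0 : 0 < expR (- 2 * s) by exact: expR_gt0.
    have : \forall y \near x, sqr_enorm y < expR (- 2 * s).
      by apply: (cvgr_lt _ (@sqr_enorm_continuous _ _ x)); rewrite x0.
    apply: filterS => y ys.
    have [y0|y0] := eqVneq (sqr_enorm y) 0; first by rewrite U0 // subrr normr0 ltW.
    have {}y0 : 0 < sqr_enorm y by rewrite lt_neqAle eq_sym y0 sqr_enorm_ge0.
    rewrite UE // /g opprB addrCA subrr addr0 ger0_norm ?expR_ge0 //; apply: hs.
    by have := ltW ys; rewrite -ler_ln ?posrE // expRK /sg; lra.
  have {}x0 : 0 < sqr_enorm x by rewrite lt_neqAle eq_sym x0 sqr_enorm_ge0.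
  have s0 : 0 <= sg (sqr_enorm x).
    rewrite /sg divr_ge0 // oppr_ge0 ln_le0 // -(sqr_sqrtr (ltW x0)) -enormE.
    by rewrite expr_le1 // enormE sqrtr_ge0.
  have cg : {for x, continuous (fun y : 'rV[R]_N => g (sqr_enorm y))}.
    apply: (continuous_comp (@sqr_enorm_continuous _ _ x)).
    exact: (is_derive_cvg (dg_pos x0 s0)).
  rewrite -/U /continuous_at UE //; apply: cvg_trans cg; apply: (@near_eq_cvg _ _ (nbhs x)).
  near=> y; rewrite UE //; near: y.
  exact: (cvgr_gt _ (@sqr_enorm_continuous _ _ x)).
- by apply: U0; rewrite /sqr_enorm big1 // => i _; rewrite mxE expr0n.
- move=> x; rewrite punctured_ballE => hx; rewrite -/U UP // /g /W.
  have := h_gt0 (sg_gt0 hx) => h.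
  by rewrite subr_gt0 expR_lt1 oppr_lt0 h /= ltrBlDr ltrDl expR_gt0.
- move=> x; rewrite /unit_sphere /= /radial_fun => ->.
  by rewrite /profile ln1 oppr0 l0 oppr0 expR0 mulr1 subrr.
rewrite punctured_ballE; split; first exact: (radial_C2 UP dg dg1 cg2).
move=> x hx; rewrite -/U (radial_laplacian UP dg dg1 hx) (radial_grad_sqr UP dg hx) UP //.
have /andP[t0 _] := hx; rewrite /g1 /g2 /g /q'.
set t := sqr_enorm x in t0 *; have tE := W_sqr t0.
have W0 : 0 < W (sg t) by exact: expR_gt0.
have -> : 1 - (1 - W (sg t)) = W (sg t) by ring.
(* Without the exponential, the equation is a rational identity in [t], [q] and [W]. *)
have -> : expR (2 * l (sg t)) = t / W (sg t) ^+ 2.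
  by rewrite -[X in X / _]tE; field; rewrite gt_eqF.
by field; rewrite !gt_eqF.
Unshelve. all: end_near. Qed.

End Solution.

(** * Distinct slopes give distinct profiles *)

Lemma is_derive_ge0_unique f (a b : R) : is_derive (0 : R) 1 f a ->
  (forall s, 0 <= s -> f s = b) -> a = 0.
Proof.
move=> [df da] fb; rewrite -da /derive.
have h := cvg_dnbhs_at_right df.
apply: (cvg_unique _ h) => //.
have c0 : (fun=> 0 : R) x @[x --> (0 : R)^'+] --> (0 : R) by exact: cvg_cst.
apply: cvg_trans c0; apply: near_eq_cvg.
near=> h0; rewrite /= /shift /= addr0 !fb ?subrr ?scaler0 //.
by rewrite [_ *: 1]mulr1 ltW.
Unshelve. all: end_near. Qed.

(** Evaluating at [r = expR (- s)] recovers [l] on [[0, +oo[], and with it the derivative [beta - 1]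
    of [l] at [0]. *)
Lemma flow_profile_inj n k lam n' k' lam' beta beta' l q l' q' :
  flow n k lam beta l q -> flow n' k' lam' beta' l' q' ->
  profile l \_ `[0, 1]%classic = profile l' \_ `[0, 1]%classic -> beta = beta'.
Proof.
move=> [_ q0 dl _] [_ q0' dl' _] E.
have ll' s : 0 <= s -> l s = l' s.
  move=> s0; have := congr1 (fun f => f (expR (- s))) E.
  rewrite /patch mem_set; last first.
    by rewrite /= in_itv /= expR_ge0 expR_le1 oppr_le0.
  rewrite /profile expRK opprK => h.
  apply: oppr_inj; apply: expR_inj; apply: (mulfI (_ : expR (- s) != 0)).
    by rewrite gt_eqF // expR_gt0.
  by move: h; lra.
have d1 := dl 0 (lexx _); have d2 := dl' 0 (lexx _).
have := is_derive_ge0_unique (is_derive_fD d1 (is_derive_fN d2)).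
move=> /(_ 0) h; apply/eqP; rewrite -subr_eq0; apply/eqP; rewrite -[RHS]h.
  by rewrite q0 q0'; ring.
by move=> s s0; rewrite ll' // subrr.
Qed.

Lemma infinitely_many_profiles_flow n k lam (P : (R -> R) -> Prop) (b1 b2 : R) : b1 < b2 ->
  (forall beta, b1 < beta < b2 -> exists l q, flow n k lam beta l q /\ P (profile l)) ->
  infinitely_many_profiles P.
Proof.
(* The denominators start at [2], so that every slope lies strictly between [b1] and [b2]. *)
move=> b12 H; pose b (i : nat) := b1 + (b2 - b1) / i.+2%:R.
have bin i : b1 < b i < b2.
  rewrite /b ltrDl divr_gt0 ?subr_gt0 //= -ltrBrDl ltr_pdivrMr // ltr_pMr ?subr_gt0 //.
  by rewrite ltr1n.
have [l hl] : {l : nat -> R -> R & forall i, exists q,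
    flow n k lam (b i) (l i) q /\ P (profile (l i))}.
  by apply: (@choice _ _ (fun i l => exists q,
    flow n k lam (b i) l q /\ P (profile l))) => i; exact: H.
pose F i := profile (l i) \_ `[0, 1]%classic.
have Finj : injective F.
  move=> i j Fij; have [q [fi _]] := hl i; have [q' [fj _]] := hl j.
  have /addrI/eqP := flow_profile_inj fi fj Fij.
  have b0 : b2 - b1 != 0 by rewrite subr_eq0 gt_eqF.
  by move=> /eqP/(mulfI b0)/invr_inj/eqP; rewrite eqr_nat => /eqP[].
move=> /(@finite_preimage _ _ _ F (in2W Finj)); apply/infiniteP.
rewrite (_ : F @^-1` _ = setT) ?card_lexx //; apply/seteqP; split => // i _.
by have [q [_ Pi]] := hl i; exists (profile (l i)).
Qed.

End Profile.

(** * Behaviour at the origin *)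

Section Asymptotics.
Context {R : realType}.
Implicit Types (f g H df dg dH l q : R -> R) (k m lam beta s t : R).

Definition vanishes f : Prop :=
  forall e, 0 < e -> exists2 s, 0 <= s & forall t, s <= t -> `|f t| <= e.

(* Barbalat: once [`|g| > e], it stays above [e / 2] for a fixed time, during
   which [H] loses a fixed amount. *)
Lemma vanishes_lyapunov g dg H dH (c K M : R) : 0 < c ->
  (forall s, 0 <= s -> is_derive s 1 g (dg s)) -> (forall s, 0 <= s -> `|dg s| <= K) ->
  (forall s, 0 <= s -> is_derive s 1 H (dH s)) ->
  (forall s, 0 <= s -> dH s <= - (c * g s ^+ 2)) -> (forall s, 0 <= s -> M <= H s) ->
  vanishes g.
Proof.
move=> c0 hg hK hH hdH hM e e0.
have K0 : 0 <= K by apply: le_trans (hK 0 (lexx 0)).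
(* During a time [tau], [g] varies by at most [e / 2]. *)
pose tau := e / (2 * (K + 1)).
have tau0 : 0 < tau by rewrite divr_gt0 // mulr_gt0 //; lra.
have Ktau : K * tau <= e / 2.
  rewrite (_ : e / 2 = (K + 1) * tau); last by rewrite /tau; field; rewrite gt_eqF //; lra.
  by rewrite ler_wpM2r ?ltW // ltrDl.
pose a := c * (e / 2) ^+ 2.
have a0 : 0 < a by rewrite mulr_gt0 // exprn_gt0 // divr_gt0.
pose A := [set H s | s in [set s | 0 <= s]].
have Ainf : has_inf A.
  split; first by exists (H 0), 0 => /=.
  by exists M => _ [s s0 <-]; apply: hM.
(* From [S] on, [H] can lose less than [a * tau] before falling below its infimum. *)
have [_ [S S0 <-] HS] := inf_adherent (mulr_gt0 a0 tau0) Ainf.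
exists S => // s Ss; rewrite leNgt; apply/negP => es.
have s0 : 0 <= s := le_trans S0 Ss.
have dec (b x y : R) : 0 <= x -> x <= y -> (forall t, x < t < y -> b <= g t ^+ 2) ->
    H y + c * b * y <= H x + c * b * x.
  move=> x0 xy hb.
  rewrite -lerN2; apply: (@ge0_derive_homo _ (fun t => - (H t + c * b * t))
    (fun t => - (dH t + c * b))) => //.
    by move=> t /andP[xt _]; have := hH t (le_trans x0 xt) => ?; derive_tac; ring.
  move=> t /andP[xt ty]; have := hdH t (le_trans x0 (ltW xt)).
  by have := ler_wpM2l (ltW c0) (hb t _); rewrite xt ty => /(_ isT); lra.
have h1 : H s <= H S.
  have := dec 0 S s S0 Ss; rewrite mulr0 !mul0r !addr0; apply => t _; exact: sqr_ge0.
have st : s <= s + tau by rewrite lerDl ltW.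
have h2 : H (s + tau) <= H s - a * tau.
  have := dec ((e / 2) ^+ 2) s (s + tau) s0 st; rewrite -/a => h.
  suff : H (s + tau) + a * (s + tau) <= H s + a * s by lra.
  apply: h => t /andP[t1 t2].
  have hL := derive_bounded_lipschitz hg hK s0 (le_trans s0 (ltW t1)).
  have h3 : K * `|s - t| <= K * tau.
    by apply: ler_wpM2l => //; rewrite ltr0_norm ?subr_lt0 //; lra.
  have h4 := ler_distD (g t) (g s) 0; rewrite !subr0 in h4.
  rewrite -[X in _ <= X]real_normK ?num_real // lerXn2r ?nnegrE ?divr_ge0 ?ltW //; lra.
have : inf A <= H (s + tau).
  by apply: ge_inf; [case: Ainf | exists (s + tau) => //=; apply: le_trans st].
by lra.
Qed.

(** If [df] exceeds [e] in absolute value, it keeps its sign and at least half that size for a time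
    [tau], so [f] moves by [e * tau / 2]; but [f] is eventually bounded by [e * tau / 8]. *)
Lemma vanishes_derive f df ddf (K : R) :
  (forall s, 0 <= s -> is_derive s 1 f (df s)) ->
  (forall s, 0 <= s -> is_derive s 1 df (ddf s)) -> (forall s, 0 <= s -> `|ddf s| <= K) ->
  vanishes f -> vanishes df.
Proof.
move=> hf hdf hK vf e e0.
have K0 : 0 <= K by apply: le_trans (hK 0 (lexx 0)).
pose tau := e / (2 * (K + 1)).
have tau0 : 0 < tau by rewrite divr_gt0 // mulr_gt0 //; lra.
have Ktau : K * tau <= e / 2.
  rewrite (_ : e / 2 = (K + 1) * tau); last by rewrite /tau; field; rewrite gt_eqF //; lra.
  by rewrite ler_wpM2r ?ltW // ltrDl.
have et0 : 0 < e * tau by rewrite mulr_gt0.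
have [|S S0 hS] := vf (e * tau / 8); first by rewrite divr_gt0.
exists S => // s Ss; have s0 : 0 <= s := le_trans S0 Ss.
have st : s <= s + tau by rewrite lerDl ltW.
have L t : s <= t -> t <= s + tau -> `|df s - df t| <= e / 2.
  move=> t1 t2; have := derive_bounded_lipschitz hdf hK s0 (le_trans s0 t1).
  move=> h; apply: le_trans h _; apply: le_trans Ktau; apply: ler_wpM2l => //.
  by rewrite ler0_norm ?subr_le0 //; lra.
rewrite leNgt; apply/negP => hds.
have := hS _ Ss; have := hS _ (le_trans Ss st); rewrite !ler_norml.
move=> /andP[u1 u2] /andP[u3 u4]; move: hds; rewrite ltr_normr => /orP[] hd.
- have : f s - e / 2 * s <= f (s + tau) - e / 2 * (s + tau).
    apply: (@ge0_derive_homo _ (fun t => f t - e / 2 * t) (fun t => df t - e / 2)) => //.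
      by move=> t /andP[h _]; have := hf t (le_trans s0 h) => ?; derive_tac; ring.
    by move=> t /andP[/ltW h1 /ltW h2]; have := L t h1 h2; rewrite ler_norml => /andP[]; lra.
  by lra.
- have : - (f s + e / 2 * s) <= - (f (s + tau) + e / 2 * (s + tau)).
    apply: (@ge0_derive_homo _ (fun t => - (f t + e / 2 * t)) (fun t => - (df t + e / 2))) => //.
      by move=> t /andP[h _]; have := hf t (le_trans s0 h) => ?; derive_tac; ring.
    by move=> t /andP[/ltW h1 /ltW h2]; have := L t h1 h2; rewrite ler_norml => /andP[]; lra.
  by lra.
Qed.

(** For [m < k] the energy is a Lyapunov function forcing [q] to [1]. Then the derivative of [q]
    tends to [0], and the equation for [q] yields the limit of [X]. *)
Lemma flow_cvg_equilibrium k m lam beta l q (c : R) : 0 < lam -> 0 < m < k ->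
  rupture_flow (k + m) k lam beta l q ->
  (forall s, 0 <= s -> energy k m lam l q s < 0) -> (forall s, 0 <= s -> c <= l s) ->
  vanishes (fun s => lam * expR (2 * l s) - m).
Proof.
move=> lam0 /andP[m0 mk] [[_ _ dl dq] _ _] En cl.
have k0 : 0 < k by apply: lt_trans mk.
have mk' : 0 < m <= k by rewrite m0 ltW.
pose X s := lam * expR (2 * l s).
pose C := (k + 1) * m / k.
have C0 : 0 < C by rewrite divr_gt0 // mulr_gt0 //; lra.
have XC s : 0 <= s -> X s < C.
  by move=> s0; have [_] := energy_inner lam0 mk' (En s s0).
have X0 s : 0 < X s by rewrite mulr_gt0 // expR_gt0.
have q1 s : 0 <= s -> `|q s - 1| <= 1.
  move=> s0; have [h _] := energy_inner lam0 mk' (En s s0).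
  by rewrite -(@ler_pXn2r _ 2) ?nnegrE // real_normK ?num_real // expr1n ltW.
have q2 s : 0 <= s -> `|q s| <= 2.
  by move=> s0; have := q1 s s0; rewrite !ler_norml => /andP[? ?]; apply/andP; split; lra.
pose dQ s := (k + m) * q s - k * q s ^+ 2 - X s.
pose K1 := (k + m) * 2 + k * 4 + C.
have dQ1 s : 0 <= s -> `|dQ s| <= K1.
  move=> s0; apply: le_trans (ler_normB _ _) _; apply: lerD.
    apply: le_trans (ler_normB _ _) _; rewrite (normrM _ (q s)) (normrM k) normrX.
    have km0 : 0 <= k + m by lra.
    rewrite (ger0_norm (ltW k0)) (ger0_norm km0); apply: lerD.
      by rewrite ler_wpM2l // q2.
    have -> : (4 : R) = 2 ^+ 2 by ring.
    by rewrite (ler_wpM2l (ltW k0)) // lerXn2r ?nnegrE // q2.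
  by rewrite gtr0_norm // ltW // XC.
have K10 : 0 <= K1 by apply: le_trans (dQ1 0 (lexx 0)).
have dX s : 0 <= s -> is_derive s 1 X (2 * X s * (q s - 1)).
  by move=> s0; have := dl s s0 => ?; rewrite /X; derive_tac; ring.
pose ddQ s := (k + m) * dQ s - 2 * k * q s * dQ s - 2 * X s * (q s - 1).
have d2 s : 0 <= s -> is_derive s 1 dQ (ddQ s).
  move=> s0; have := dq s s0; have := dX s s0 => ? ?.
  by rewrite /dQ /ddQ; derive_tac; rewrite /dQ /X; ring.
have ddQ1 s : 0 <= s -> `|ddQ s| <= (k + m) * K1 + 2 * k * 2 * K1 + 2 * C * 1.
  move=> s0; apply: le_trans (ler_normB _ _) _; apply: lerD.
    apply: le_trans (ler_normB _ _) _; rewrite !normrM.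
    rewrite (ger0_norm (ltW k0)) (@ger0_norm _ (k + m)) ?(@ger0_norm _ 2) //; last by lra.
    apply: lerD; first by apply: ler_wpM2l (dQ1 s s0); lra.
    have k2 : 0 <= 2 * k by rewrite mulr_ge0 // ltW.
    by apply: ler_pM (dQ1 s s0) => //; [exact: mulr_ge0 | apply: ler_wpM2l (q2 s s0)].
  rewrite normrM ger0_norm; last by rewrite mulr_ge0 // ltW.
  apply: ler_pM => //; first by rewrite mulr_ge0 // ltW.
    by rewrite ler_pM2l // ltW // XC.
  exact: q1.
have dq1 s : 0 <= s -> is_derive s 1 (fun s => q s - 1) (dQ s).
  by move=> s0; have := dq s s0 => ?; derive_tac; rewrite /dQ /X; ring.
have vq : vanishes (fun s => q s - 1).
  (* The lower bound [c] on [l] keeps the dissipation rate positive; the upper bound [c'] keeps the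
     energy bounded below. *)
  have [|c' c'E] := @exists_expR _ (C / lam); first by rewrite divr_gt0.
  apply: (@vanishes_lyapunov _ dQ (energy k m lam l q)
    (fun s => - (2 * (k - m) * (q s - 1) ^+ 2 * expR (2 * k * l s)))
    (2 * (k - m) * expR (2 * k * c)) K1 (- (m / k * expR (2 * k * c')))) => //.
  - by rewrite mulr_gt0 ?expR_gt0 // mulr_gt0 // subr_gt0.
  - by move=> s s0; apply: (is_derive_energy k0 (dl s s0) (dq s s0)).
  - move=> s s0; rewrite lerN2 mulrAC; apply: ler_wpM2l.
      by rewrite mulr_ge0 ?sqr_ge0 // mulr_ge0 // subr_ge0 ltW.
    by rewrite ler_expR ler_pM2l ?cl // mulr_gt0.
  - move=> s s0; rewrite /energy.
    have lc : l s <= c'.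
      suff : expR (2 * l s) <= expR (2 * c') by rewrite ler_expR; lra.
      by rewrite c'E ler_pdivlMr // mulrC ltW // XC.
    have h1 : expR (2 * k * l s) <= expR (2 * k * c').
      by rewrite ler_expR ler_pM2l // mulr_gt0.
    have h2 := ler_wpM2l (ltW (divr_gt0 m0 k0)) h1.
    have h3 := mulr_ge0 (sqr_ge0 (q s - 1)) (expR_ge0 (2 * k * l s)).
    have k1 : 0 < k + 1 by lra.
    have h4 := mulr_ge0 (ltW (divr_gt0 (X0 s) k1)) (expR_ge0 (2 * k * l s)).
    by rewrite /X in h4; lra.
have vdq := vanishes_derive dq1 d2 ddQ1 vq.
move=> e e0.
have B0 : 0 < 2 * (m + 2 * k) by rewrite mulr_gt0 // addr_gt0 // mulr_gt0.
have [S1 S10 h1] := vq _ (divr_gt0 e0 B0).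
have [S2 S20 h2] := vdq _ (divr_gt0 e0 (ltr0n R 2)).
exists (S1 + S2) => [|t St]; first exact: addr_ge0.
have t1 : S1 <= t by lra. have t2 : S2 <= t by lra.
have t0 : 0 <= t by lra.
(* The equation for [q], solved for [X - m]: both terms on the right vanish at infinity. *)
have -> : lam * expR (2 * l t) - m = (q t - 1) * (m - k * q t) - dQ t.
  by rewrite /dQ /X; ring.
apply: le_trans (ler_normB _ _) _; rewrite normrM.
have h3 : `|m - k * q t| <= m + 2 * k.
  apply: le_trans (ler_normB _ _) _; rewrite normrM (gtr0_norm m0) (gtr0_norm k0).
  by have := ler_wpM2l (ltW k0) (q2 t t0); lra.
have h4 := ler_pM (normr_ge0 _) (normr_ge0 _) (h1 t t1) h3.
have h5 := h2 t t2.
have : e / (2 * (m + 2 * k)) * (m + 2 * k) = e / 2.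
  by field; rewrite gt_eqF // addr_gt0 // mulr_gt0.
by lra.
Qed.

(** Since [w / r] is [expR (- l)], convergence of [X] to [m] means that [w / r] tends to the square
    root of [lam / m]. The remainder is defined so that the expansion is exact for every [r]. *)
Lemma profile_equivalent m lam l (c : R) : 0 < lam -> 0 < m ->
  (forall s, 0 <= s -> c <= l s) -> vanishes (fun s => lam * expR (2 * l s) - m) ->
  exists2 e : R -> R, e r @[r --> 0^'+] --> (0 : R) &
    forall r, profile l r = 1 - Num.sqrt (lam / m) * r * (1 + e r).
Proof.
move=> lam0 m0 cl vX.
pose B := Num.sqrt (m / lam).
have B2 : B ^+ 2 = m / lam by rewrite sqr_sqrtr // divr_ge0 // ltW.
exists (fun r => expR (- l (- ln r)) * B - 1); last first.
  move=> r; rewrite /profile addrCA subrr addr0.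
  have : Num.sqrt (lam / m) * B = 1.
    rewrite /B -sqrtrM ?divr_ge0 ?ltW // (_ : lam / m * (m / lam) = 1) ?sqrtr1 //.
    by field; rewrite !gt_eqF.
  move=> AB; congr (1 - _).
  rewrite (_ : _ * r * _ = Num.sqrt (lam / m) * B * (r * expR (- l (- ln r)))); last by ring.
  by rewrite AB mul1r.
apply/cvgrPdist_le => e e0.
have d0 : 0 < lam * expR (2 * c) by rewrite mulr_gt0 // expR_gt0.
have [S S0 hS] := vX _ (mulr_gt0 e0 d0).
near=> r; rewrite sub0r normrN.
have r0 : 0 < r by near: r; exact: nbhs_right_gt.
have rS : S <= - ln r.
  have : r <= expR (- S) by near: r; apply: nbhs_right_le; exact: expR_gt0.
  by rewrite -ler_ln ?posrE ?expR_gt0 // expRK; lra.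
set s := - ln r in rS *; have s0 : 0 <= s := le_trans S0 rS.
pose y := expR (- l s) * B.
have y0 : 0 <= y by rewrite mulr_ge0 ?expR_ge0 // sqrtr_ge0.
have y2 : y ^+ 2 - 1 = - (lam * expR (2 * l s) - m) / (lam * expR (2 * l s)).
  have -> : y ^+ 2 = (expR (2 * l s))^-1 * (m / lam).
    by rewrite exprMn B2 -expRN expr2 -expRD; congr (expR _ * _); ring.
  by field; rewrite !gt_eqF ?expR_gt0.
(* As [y + 1 >= 1], the square may be compared with [1] instead of [y]. *)
apply: (@le_trans _ _ `|y ^+ 2 - 1|).
  rewrite -/y subr_sqr_1 normrM ler_peMr // ger0_norm; lra.
rewrite y2 mulNr normrN normrM normfV (@gtr0_norm _ (_ * _)) ?mulr_gt0 ?expR_gt0 //.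
rewrite ler_pdivrMr ?mulr_gt0 ?expR_gt0 //; apply: le_trans (hS s rS) _.
rewrite ler_pM2l // ler_pM2l // ler_expR; have := cl s s0; lra.
Unshelve. all: end_near. Qed.

(** For [m = k], [X < k + 1] bounds [w / r] strictly from below, and the lower bound on [l] bounds
    it from above. *)
Lemma profile_between k lam l q (c : R) : 0 < lam -> 0 < k ->
  (forall s, 0 <= s -> energy k k lam l q s < 0) -> (forall s, 0 <= s -> c <= l s) ->
  exists2 a, 1 < a & forall r, 0 < r -> r < 1 ->
    1 - Num.sqrt (lam / (k + 1)) * a * r <= profile l r /\
    profile l r < 1 - Num.sqrt (lam / (k + 1)) * r.
Proof.
move=> lam0 k0 En cl; have k1 : 0 < k + 1 by lra.
set A := Num.sqrt _; have lk : 0 < lam / (k + 1) by rewrite divr_gt0.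
have A0 : 0 < A by rewrite sqrtr_gt0.
(* The summand [1] ensures [a > 1]; the other makes [A * a] exceed [expR (- c)]. *)
exists (1 + expR (- c) / A); first by rewrite ltrDl divr_gt0 // expR_gt0.
move=> r r0 r1; rewrite /profile; set s := - ln r.
have s0 : 0 <= s by rewrite oppr_ge0 ln_le0 // ltW.
have h1 : expR (- l s) <= expR (- c) by rewrite ler_expR lerN2 cl.
have h2 : A < expR (- l s).
  rewrite -(@ltr_pXn2r _ 2) ?nnegrE ?expR_ge0 ?ltW // sqr_sqrtr ?ltW //.
  have kk : 0 < k <= k by rewrite k0 lexx.
  have [_] := energy_inner lam0 kk (En s s0).
  rewrite mulfK ?gt_eqF // => h.
  rewrite expr2 -expRD (_ : - l s + - l s = - (2 * l s)); last by ring.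
  by rewrite expRN ltr_pdivrMr // mulrC ltr_pdivlMr ?expR_gt0.
have h3 := ler_wpM2l (ltW r0) h1; have h4 : r * A < r * expR (- l s) by rewrite ltr_pM2l.
have -> : A * (1 + expR (- c) / A) * r = A * r + r * expR (- c) by field; rewrite gt_eqF.
by have := mulr_gt0 A0 r0; split; lra.
Qed.

End Asymptotics.

(** * Choice of slopes in the three ranges of parameters *)

Unset Implicit Arguments.

Theorem theorem1p4 (R : realType) (N : nat) (delta : R)
    (hN : (2 <= N)%N) (hdelta : N%:R / 2 <= delta) :
  [/\ (* (i) *)
      (N = 2)%N ->
        (exists2 lambda2 : R, 0 < lambda2 &
           forall lambda : R, 0 < lambda -> lambda < lambda2 ->
             infinitely_many_profiles (rupture_solution N delta lambda)) /\
        (delta = 1 ->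
           forall lambda : R, 0 < lambda -> lambda < 1 ->
             infinitely_many_profiles (rupture_solution N delta lambda)),
      (* (ii) *)
      (3 <= N)%N -> delta < N%:R - 1 ->
        forall lambda : R, 0 < lambda ->
          lambda < delta * (N%:R - 1 - delta) / (delta - 1) ->
          infinitely_many_profiles (fun u : R -> R =>
            [/\ rupture_solution N delta lambda u,
                (* (ii1) *)
                N%:R / 2 < delta ->
                  exists2 e : R -> R, e r @[r --> 0^'+] --> (0 : R) &
                    \forall r \near 0^'+,
                      u r = 1 - Num.sqrt (lambda / (N%:R - 1 - delta)) * r
                                * (1 + e r)
              & (* (ii2) *)
                delta = N%:R / 2 ->
                  exists2 c : R, 1 < c &
                    forall r : R, 0 < r -> r < 1 ->
                      1 - Num.sqrt (2 * lambda / N%:R) * c * r <= u r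
                      /\ u r < 1 - Num.sqrt (2 * lambda / N%:R) * r])
    & (* (iii) *)
      (3 <= N)%N -> N%:R - 1 <= delta ->
        exists2 lambda4 : R, 0 < lambda4 &
          forall lambda : R, 0 < lambda -> lambda < lambda4 ->
            infinitely_many_profiles (rupture_solution N delta lambda)].
Proof.
have delta1 : 1 <= delta.
  apply: le_trans hdelta; rewrite ler_pdivlMr // mul1r.
  by rewrite (ler_nat R 2).
have k0 : 0 <= delta - 1 by lra.
have one_flow (lam beta : R) :
    (exists l q, rupture_flow (N%:R - 2) (delta - 1) lam beta l q) ->
    exists l q, flow (N%:R - 2) (delta - 1) lam beta l q /\
      rupture_solution N delta lam (profile l).
  move=> [l [q lq]]; exists l, q; split; first by case: lq.
  exact: rupture_solution_profile lq.
have N3 : (3 <= N)%N -> (3 : R) <= N%:R by rewrite (ler_nat R 3).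
split.
- move=> N2; have n0 : N%:R - 2 = 0 :> R by rewrite N2 subrr.
  split.
    exists (32 * delta)^-1; first by rewrite invr_gt0 mulr_gt0 //; lra.
    move=> lam lam0 lam1; apply: (@infinitely_many_profiles_flow _ (N%:R - 2)
      (delta - 1) lam _ 4^-1 2^-1) => [|beta hb]; first by lra.
    apply: (one_flow lam beta); rewrite n0.
    by apply: rupture_flow_plane => //; rewrite lam0 subrK.
  (* For these slopes [0 < beta - 1 < 1 - lam < 1], whence [(beta - 1) ^ 2 < 1 - lam]. *)
  move=> d1 lam lam0 lam1; apply: (@infinitely_many_profiles_flow _ (N%:R - 2)
    (delta - 1) lam _ 1 (2 - lam)) => [|beta /andP[b1 b2]]; first by lra.
  apply: (one_flow lam beta); rewrite n0 d1 subrr.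
  apply: rupture_flow_conservative => //.
  have : 0 <= (beta - 1) * (2 - lam - beta) by rewrite mulr_ge0 //; lra.
  have : 0 < lam * (2 - beta) by rewrite mulr_gt0 //; lra.
  by nra.
- move=> /N3 hN3 dN lam lam0 lam1.
  have kp : 0 < delta - 1 by lra.
  set k := delta - 1 in k0 one_flow lam1 kp *.
  set m := N%:R - 1 - delta in lam1 *.
  (* The two inequalities are [delta < N - 1] and [N / 2 <= delta]. *)
  have mk : 0 < m <= k by rewrite /m /k; apply/andP; split; lra.
  have nE : N%:R - 2 = k + m by rewrite /k /m; ring.
  have dE : delta = k + 1 by rewrite /k; ring.
  (* Positivity of [gap] is exactly the assumed upper bound on [lam]. Slopes with
     [0 < beta - 1 < Num.min 1 gap] have [(beta - 1) ^ 2 < gap], so negative initial energy. *)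
  pose gap := m / k - lam / (k + 1).
  have gap0 : 0 < gap.
    rewrite subr_gt0 ltr_pdivrMr; last by lra.
    by rewrite mulrC mulrA -dE.
  have minb : 0 < Num.min 1 gap by rewrite lt_min ltr01.
  apply: (@infinitely_many_profiles_flow _ (N%:R - 2) k lam _ 1 (1 + Num.min 1 gap)).
    by rewrite ltrDl.
  move=> beta /andP[b1 b2].
  have [b3 b4] : beta - 1 < 1 /\ beta - 1 < gap.
    by have : beta - 1 < Num.min 1 gap; [lra | rewrite lt_min => /andP[]].
  have b5 : (beta - 1) ^+ 2 + lam / (k + 1) < m / k.
    have : (beta - 1) * (beta - 1) <= (beta - 1) * 1 by apply: ler_wpM2l; lra.
    by rewrite /gap in b4; rewrite expr2; lra.
  have [l [q [lq En [c cl]]]] := rupture_flow_energy lam0 mk b5.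
  have /andP[m0 mk'] := mk.
  exists l, q; rewrite nE; split; first by case: lq.
  split.
  + by apply: (@rupture_solution_profile _ N delta lam beta l q); rewrite nE.
  + move=> dN2; have mk2 : 0 < m < k by rewrite m0 /= /m /k; lra.
    have vX := flow_cvg_equilibrium lam0 mk2 lq En cl.
    have [e e0 eE] := profile_equivalent lam0 m0 cl vX.
    by exists e => //; apply: nearW.
  + move=> dN2; have mkE : m = k by rewrite /m /k; lra.
    have -> : 2 * lam / N%:R = lam / (k + 1) by rewrite -dE dN2; field; rewrite gt_eqF //; lra.
    by rewrite mkE in En; exact: profile_between lam0 kp En cl.
- move=> /N3 hN3 dN; have kp : 0 < delta - 1 by lra.
  set k := delta - 1 in k0 one_flow kp *.
  set n : R := N%:R - 2 in one_flow *.
  have n1 : 0 < n by rewrite /n; lra.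
  have nk : n <= k by rewrite /n /k; lra.
  have nk0 : 0 < n / k by rewrite divr_gt0.
  (* This is the maximum of [n * x - k * x ^ 2], attained at [x = n / k / 2], which serves as the
     lower side of the box. *)
  exists (n ^+ 2 / (4 * k)); first by rewrite divr_gt0 ?exprn_gt0 ?mulr_gt0.
  move=> lam lam0 lam1.
  apply: (@infinitely_many_profiles_flow _ n k lam _ (n / k / 2) (n / k)); first by lra.
  move=> beta /andP[b1 b2]; apply: (one_flow lam beta).
  apply: (@rupture_flow_box _ n k lam beta (n / k / 2)) => //.
  + by rewrite nk ltW.
  + by rewrite divr_gt0.
  + by rewrite !ltW.
  + rewrite lam0 /=; apply: le_trans (ltW lam1) _.
    by rewrite le_eqVlt; apply/orP; left; apply/eqP; field; rewrite gt_eqF.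
Qed.
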